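(* Let $K$ be a field, let $u_1,\ldots,u_m$ be squarefree monomials of the same degree in $S=K[x_1,\ldots,x_n]$, and let $I=B_1(u_1,\ldots,u_m)$. Then for all $k$, $$\operatorname{height}(\operatorname{HS}_{k+1}(I))\le\operatorname{height}(\operatorname{HS}_k(I))\quad\text{and}\quad \ell(\operatorname{HS}_{k+1}(I))\le\ell(\operatorname{HS}_k(I)).$$
   Context: $\operatorname{supp}(u)=\{i:x_i\mid u\}$. A squarefree monomial ideal $I$ (one generated by squarefree monomials) is a squarefree Borel ideal (also called $1$-Borel) if for every squarefree monomial $u\in I$, every $j\in\operatorname{supp}(u)$ and every $i<j$ one has $x_i(u/x_j)\in I$, provided $x_i(u/x_j)$ is squarefree. $B_1(u_1,\ldots,u_m)$ is the smallest squarefree Borel ideal containing $u_1,\ldots,u_m$. For a monomial ideal $I\subset S$ with minimal $\mathbb Z^n$-graded free resolution $\mathbb F\to I$, $F_i=\bigoplus_{j=1}^{b_i}S(-\mathbf a_{ij})$, the $i$th homological shift ideal ($i\ge0$) is $\operatorname{HS}_i(I)=(\mathbf x^{\mathbf a_{ij}}: j=1,\ldots,b_i)$; so $\operatorname{HS}_0(I)=I$, and $\operatorname{HS}_i(I)=0$ if $F_i=0$. $\ell(J)$ denotes the analytic spread of $J$, the Krull dimension of the fiber ring $\bigoplus_{r\ge0}J^r/\mathfrak mJ^r$ with $\mathfrak m=(x_1,\ldots,x_n)$. The zero ideal has height $0$ and analytic spread $0$. *)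

(* Defs.v *)
From HB Require Import structures.
From mathcomp Require Import all_boot all_order all_algebra.
(* mpoly has to come before constructive_ereal: in the other order their
   notations are incompatible. *)
From mathcomp Require Import mpoly.
From mathcomp Require Import boolp classical_sets constructive_ereal.

Set Implicit Arguments.
Unset Strict Implicit.
Unset Printing Implicit Defensive.

Import Order.TTheory GRing.Theory.

Local Open Scope classical_set_scope.
Local Open Scope ring_scope.

Section Ideals.
Variable A : comNzRingType.
Implicit Types (I J G P : set A) (a x y : A).

Definition is_ideal I :=
  [/\ I 0, (forall x y, I x -> I y -> I (x + y)) & forall a x, I x -> I (a * x)].

Definition ideal_gen G : set A := smallest is_ideal G.

Definition ideal_mul I J : set A :=
  ideal_gen [set z | exists x y, [/\ I x, J y & z = x * y]].

Definition ideal_pow J (r : nat) : set A := iter r (ideal_mul J) setT.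

Definition prime_ideal P :=
  [/\ is_ideal P, ~ P 1 & forall x y, P (x * y) -> P x \/ P y].

(* P 0 < P 1 < ... < P d; the values of P beyond d are irrelevant. *)
Definition prime_chain (P : nat -> set A) (d : nat) :=
  (forall i, (i <= d)%N -> prime_ideal (P i)) /\
  (forall i, (i < d)%N -> P i `<` P i.+1).

(* Dimensions and heights live in \bar int, where every set of natural numbers
   has a supremum and an infimum; only nonnegative values and +oo occur for
   nonzero rings. *)
Definition prime_height P : \bar int :=
  supremum -oo%E
    [set (Posz d)%:E | d in [set d | exists2 C, prime_chain C d & C d = P]].

(* The unit ideal is contained in no prime and has height +oo. *)
Definition height I : \bar int :=
  infimum +oo%E
    [set prime_height P | P in [set P | prime_ideal P /\ I `<=` P]].

Lemma ideal_genP G : is_ideal (ideal_gen G).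
Proof.
split=> [|x y Ix Iy|a x Ix] H HG; have [[H0 HD HM] _] := HG; first exact: H0.
  exact: HD (Ix H HG) (Iy H HG).
exact: HM (Ix H HG).
Qed.

Lemma ideal_mulP I J : is_ideal (ideal_mul I J).
Proof. exact: ideal_genP. Qed.

Lemma ideal_powP J r : is_ideal (ideal_pow J r).
Proof. by case: r => [|r]; [split | exact: ideal_mulP]. Qed.

Lemma ideal_mul_mem I J x y : I x -> J y -> ideal_mul I J (x * y).
Proof. by move=> Ix Jy H [_ GH]; apply: GH; exists x, y. Qed.

(* If y multiplies J into L then it multiplies I J into I L. *)
Lemma ideal_mul_mulr I J (L : set A) y :
    (forall x, J x -> L (x * y)) ->
  forall x, ideal_mul I J x -> ideal_mul I L (x * y).
Proof.
move=> JL x Hx; refine (Hx [set x | ideal_mul I L (x * y)] _); split.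
  have [H0 HD HM] := ideal_mulP I L.
  split=> /= [|u v Hu Hv|a u Hu]; first by rewrite mul0r; exact: H0.
    by rewrite mulrDl; exact: HD.
  by rewrite -mulrA; exact: HM.
by move=> _ [u [v [Iu Jv ->]]] /=; rewrite -mulrA; exact: ideal_mul_mem (JL _ Jv).
Qed.

Lemma ideal_powD J r s x y :
  ideal_pow J r x -> ideal_pow J s y -> ideal_pow J (r + s) (x * y).
Proof.
move=> + Jy; elim: r x => [|r IH] x /=.
  by move=> _; case: (ideal_powP J s) => _ _; apply.
exact: ideal_mul_mulr.
Qed.

Lemma is_ideal_sum I (T : Type) (r : seq T) (Q : pred T) (F : T -> A) :
  is_ideal I -> (forall i, Q i -> I (F i)) -> I (\sum_(i <- r | Q i) F i).
Proof. by move=> [I0 ID _] IF; apply: big_ind. Qed.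

Lemma is_idealB I x y : is_ideal I -> I x -> I y -> I (x - y).
Proof. by move=> [_ ID IM] Ix Iy; apply: ID => //; rewrite -mulN1r; apply: IM. Qed.

End Ideals.

Definition krull_dim (A : comNzRingType) : \bar int :=
  supremum -oo%E
    [set (Posz d)%:E | d in [set d | exists C : nat -> set A, prime_chain C d]].

(* The Rees algebra, the direct sum of the J ^ r, as a subring of A[t]. *)
Section Rees.
Variables (A : comNzRingType) (J : set A).

Definition rees_pred : {pred {poly A}} :=
  fun p => `[< forall r, ideal_pow J r p`_r >].

Lemma rees_predP (p : {poly A}) :
  reflect (forall r, ideal_pow J r p`_r) (p \in rees_pred).
Proof. exact: asboolP. Qed.

Lemma rees_subring_closed : subring_closed rees_pred.
Proof.
split=> [|p q /rees_predP Hp /rees_predP Hq|p q /rees_predP Hp /rees_predP Hq];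
  apply/rees_predP => r.
- rewrite coef1; case: r => [|r] //.
  by case: (ideal_powP J r.+1).
- by rewrite coefB; apply: is_idealB => //; exact: ideal_powP.
- rewrite coefM; apply: is_ideal_sum => [|i _]; first exact: ideal_powP.
  by rewrite -[r in ideal_pow J r](subnKC (ltn_ord i : i <= r)%N); apply: ideal_powD.
Qed.

HB.instance Definition _ :=
  GRing.isSubringClosed.Build {poly A} rees_pred rees_subring_closed.

Record rees := Rees { rees_val :> {poly A}; _ : rees_val \in rees_pred }.

HB.instance Definition _ := [isSub for rees_val].
HB.instance Definition _ := [Choice of rees by <:].
HB.instance Definition _ := [SubChoice_isSubComNzRing of rees by <:].

End Rees.

Section FiberRing.
Variables (K : fieldType) (n : nat).
Local Notation S := {mpoly K[n]}.

Definition irrelevant_ideal : set S := ideal_gen (range (fun i : 'I_n => 'X_i)).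

Variable J : set S.

(* The ideal m R(J) of the Rees algebra, the direct sum of the m J ^ r. *)
Definition fiber_pred : {pred rees J} :=
  fun p => `[< forall r, ideal_mul irrelevant_ideal (ideal_pow J r)
                           (rees_val p)`_r >].

Lemma fiber_predP (p : rees J) :
  reflect (forall r, ideal_mul irrelevant_ideal (ideal_pow J r) (rees_val p)`_r)
          (p \in fiber_pred).
Proof. exact: asboolP. Qed.

Lemma irrelevant_mcoeff0 (f : S) : irrelevant_ideal f -> f@_0%MM = 0.
Proof.
move=> Hf; refine (Hf [set f | f@_0%MM = 0] _); split.
  split=> /= [|x y Hx Hy|a x Hx]; first exact: mcoeff0.
    by rewrite mcoeffD Hx Hy addr0.
  by rewrite -/(mcoeff 0%MM (a * x)) rmorphM /= Hx mulr0.
by move=> _ [i _ <-] /=; rewrite mcoeffX mnm1_eq0.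
Qed.

Lemma fiber_idealr_closed : idealr_closed fiber_pred.
Proof.
split.
- apply/fiber_predP => r.
  by rewrite coef0; case: (ideal_mulP irrelevant_ideal (ideal_pow J r)).
- apply/negP => /fiber_predP /(_ 0%N); rewrite coef1 /=.
  move=> H; have /eqP := oner_neq0 K; apply.
  have /irrelevant_mcoeff0 : irrelevant_ideal 1.
    refine (H irrelevant_ideal _); split; first exact: ideal_genP.
    move=> _ [x [y [Hx _ ->]]]; rewrite mulrC.
    by case: (ideal_genP (range (fun i : 'I_n => 'X_i : S))) => _ _; apply.
  by rewrite mcoeff1 eqxx.
- move=> a p q /fiber_predP Hp /fiber_predP Hq; apply/fiber_predP => r.
  rewrite coefD; case: (ideal_mulP irrelevant_ideal (ideal_pow J r)) => _ HD _.
  apply: HD; last exact: Hq.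
  rewrite coefM; apply: is_ideal_sum => [|i _]; first exact: ideal_mulP.
  have /rees_predP/(_ i) Ha := valP a; have le_ir : (i <= r)%N := ltn_ord i.
  rewrite mulrC; apply: ideal_mul_mulr (Hp (r - i)%N) => x Jx.
  by rewrite -[r in ideal_pow J r](subnK le_ir); apply: ideal_powD.
Qed.

HB.instance Definition _ :=
  isIdealr.Build (rees J) fiber_pred fiber_idealr_closed.

Definition fiber_ring : comNzRingType := {ideal_quot fiber_pred}.

Definition analytic_spread : \bar int := krull_dim fiber_ring.

End FiberRing.

Section SquarefreeBorel.
Variables (K : fieldType) (n : nat).
Local Notation S := {mpoly K[n]}.

Definition squarefree_mnm (u : 'X_{1..n}) := forall i, (u i <= 1)%N.

Definition squarefree_monomial_ideal (I : set S) :=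
  exists G : set 'X_{1..n},
    G `<=` squarefree_mnm /\ I = ideal_gen [set 'X_[u] | u in G].

Definition squarefree_borel (I : set S) :=
  squarefree_monomial_ideal I /\
  forall (u : 'X_{1..n}) (i j : 'I_n),
    squarefree_mnm u -> I 'X_[u] -> u j != 0%N -> (i < j)%N ->
    let v := (u - U_(j) + U_(i))%MM in squarefree_mnm v -> I 'X_[v].

Definition B1 (m : nat) (u : 'I_m -> 'X_{1..n}) : set S :=
  smallest squarefree_borel (range (fun i => 'X_[u i])).

End SquarefreeBorel.

Arguments B1 K {n m} u.

(* F_i is the free module of row vectors of length mres_rank i, whose j-th
   basis vector has multidegree mres_shift i j; the differential F_(i+1) -> F_i
   and the augmentation F_0 -> S act by right multiplication. Shifts are taken
   in N^n rather than Z^n: for an ideal of S the shifts of a minimal resolution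
   are all of this form. *)
Record mgraded_complex (K : fieldType) (n : nat) := MGradedComplex {
  mres_rank : nat -> nat;
  mres_shift : forall i, 'I_(mres_rank i) -> 'X_{1..n};
  mres_diff : forall i, 'M[{mpoly K[n]}]_(mres_rank i.+1, mres_rank i);
  mres_aug : 'cV[{mpoly K[n]}]_(mres_rank 0)
}.

Section Resolutions.
Variables (K : fieldType) (n : nat).
Local Notation S := {mpoly K[n]}.
Implicit Type F : mgraded_complex K n.

(* The maps preserve multidegrees: f e_l has degree a precisely when every
   monomial of f has degree a - shift e_l. *)
Definition mgraded_maps F :=
  (forall j x, x \in msupp (mres_aug F j 0) -> x = mres_shift j) /\
  (forall i j l x, x \in msupp (mres_diff F i j l) ->
     (x + mres_shift l)%MM = mres_shift j).

Definition resolves F (I : set S) :=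
  [/\ range (fun v : 'rV[S]_(mres_rank F 0) => (v *m mres_aug F) 0 0) = I,
      (forall v : 'rV[S]_(mres_rank F 0),
         v *m mres_aug F = 0 <-> exists w, v = w *m mres_diff F 0)
    & (forall i (v : 'rV[S]_(mres_rank F i.+1)),
         v *m mres_diff F i = 0 <-> exists w, v = w *m mres_diff F i.+1)].

Definition minimal_complex F :=
  forall i j l, irrelevant_ideal (mres_diff F i j l).

Definition minimal_mgraded_resolution F (I : set S) :=
  [/\ mgraded_maps F, resolves F I & minimal_complex F].

Definition homological_shift F (i : nat) : set S :=
  ideal_gen (range (fun j : 'I_(mres_rank F i) => 'X_[mres_shift j])).

End Resolutions.

(* Main.v *)
(** Let I be the squarefree Borel ideal and G its (degree d) generators. The
    shifts of F_k are found from the complexes F / (x_p : p in T) F in a fixed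
    multidegree a: adding a variable to T gives a short exact sequence, so for
    squarefree a one starts with T = {max a}, where all homology vanishes except
    that the homology at F_0 is nonzero exactly when a is in G, and adds the other
    variables of a one at a time. Hence a is a shift of F_k if and only if a is
    squarefree of degree d + k and contains some g in G with max g = max a; in
    particular HS_{k+1} is contained in HS_k, and the heights decrease.

    The shifts of F_k form a Borel set A_k. If w is in A_{k+1} and i < j with
    j in w and i not in w, then e_j - e_i is a difference of two elements of A_k;
    so all differences of elements of A_{k+1} lie in the span of the differences
    of elements of A_k, and the rank of the exponent matrix (with a column of
    ones) does not increase with k.

    Finally, the analytic spread of an ideal generated by monomials of the same
    degree is that rank. Elements p_i in P_{i+1} \ P_i along a chain of primes are
    algebraically independent, which by counting monomials bounds the length of a
    chain by the rank; setting the variables of a maximal set of independent columns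
    to 1 one after the other gives a chain of primes whose length is the rank. *)

Require Import Defs.
From mathcomp Require Import all_boot all_order all_algebra.
From mathcomp Require Import mpoly.
From mathcomp Require Import boolp classical_sets constructive_ereal.
From HB Require Import structures.
From mathcomp Require Import zify.

Set Implicit Arguments.
Unset Strict Implicit.
Unset Printing Implicit Defensive.

Import Order.TTheory GRing.Theory Num.Theory.

Local Open Scope classical_set_scope.
Local Open Scope ring_scope.

(** * Short exact sequences of based complexes *)

Section Subquotients.
Variables (K : fieldType) (r : nat -> nat).
Variable c : forall i, 'M[K]_(r i.+1, r i).
Implicit Types P A B C : forall i, pred 'I_(r i).

(** The predicate [P] selects basis vectors. Rows fixed by [restrict P] are the chains of the
    subquotient they span, and [bd] is its induced differential. *)
Definition restrict P i (v : 'rV[K]_(r i)) : 'rV[K]_(r i) :=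
  \row_j (if P i j then v 0 j else 0).

Definition bd P i (v : 'rV[K]_(r i.+1)) := restrict P (v *m c i).

Definition acyclic_at P i :=
  forall v : 'rV[K]_(r i.+1), restrict P v = v -> bd P v = 0 ->
  exists w : 'rV[K]_(r i.+2), restrict P w = w /\ bd P w = v.

Lemma restrictD P i (v w : 'rV[K]_(r i)) : restrict P (v + w) = restrict P v + restrict P w.
Proof. by apply/rowP=> j; rewrite !mxE; case: (P i j); rewrite ?addr0. Qed.

Lemma restrictN P i (v : 'rV[K]_(r i)) : restrict P (- v) = - restrict P v.
Proof. by apply/rowP=> j; rewrite !mxE; case: (P i j); rewrite ?oppr0. Qed.

Lemma restrict0 P i : restrict P (0 : 'rV[K]_(r i)) = 0.
Proof. by apply/rowP=> j; rewrite !mxE; case: (P i j). Qed.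

Lemma restrictK P i (v : 'rV[K]_(r i)) : restrict P (restrict P v) = restrict P v.
Proof. by apply/rowP=> j; rewrite !mxE; case: (P i j). Qed.

Lemma bdD P i (v w : 'rV[K]_(r i.+1)) : bd P (v + w) = bd P v + bd P w.
Proof. by rewrite /bd mulmxDl restrictD. Qed.

Lemma bdN P i (v : 'rV[K]_(r i.+1)) : bd P (- v) = - bd P v.
Proof. by rewrite /bd mulNmx restrictN. Qed.

(** By [closedA] the vectors in [A] span a subcomplex of the complex on [B], and [C] is a basis of
    the quotient: a short exact sequence 0 -> A -> B -> C -> 0. *)
Variables A B C : forall i, pred 'I_(r i).
Hypothesis BAC : forall i (j : 'I_(r i)), B j = A j || C j.
Hypothesis AC0 : forall i (j : 'I_(r i)), A j -> ~~ C j.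
Hypothesis closedA : forall i j l, c i j l != 0 -> A j -> B l -> A l.
Hypothesis bdB2 : forall i (v : 'rV[K]_(r i.+2)),
  restrict B v = v -> bd B (bd B v) = 0.

Let rsBAC i (v : 'rV[K]_(r i)) : restrict B v = restrict A v + restrict C v.
Proof.
apply/rowP=> j; rewrite !mxE BAC; case: (boolP (A j)) => [/AC0/negbTE->|_] /=.
  by rewrite addr0.
by rewrite add0r.
Qed.

Let rsCB i (v : 'rV[K]_(r i)) : restrict C (restrict B v) = restrict C v.
Proof. by apply/rowP=> j; rewrite !mxE BAC; case: (C j); rewrite ?orbT. Qed.

Let rsBC i (v : 'rV[K]_(r i)) : restrict B (restrict C v) = restrict C v.
Proof. by apply/rowP=> j; rewrite !mxE BAC; case: (C j); rewrite ?orbT ?if_same. Qed.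

Let rsBA i (v : 'rV[K]_(r i)) : restrict B (restrict A v) = restrict A v.
Proof. by apply/rowP=> j; rewrite !mxE BAC; case: (A j); rewrite /= ?if_same. Qed.

Let bdAC i (v : 'rV[K]_(r i.+1)) : restrict A v = v -> bd C v = 0.
Proof.
move=> Av; apply/rowP=> l; rewrite !mxE; case: ifP => // Cl.
rewrite big1 // => j _; rewrite -Av mxE; case: ifP => [Aj|]; last by rewrite mul0r.
case: (eqVneq (c i j l) 0) => [->|nz]; first by rewrite mulr0.
have /(closedA nz Aj)/AC0 : B l by rewrite BAC Cl orbT.
by rewrite Cl.
Qed.

Let bdA i (v : 'rV[K]_(r i.+1)) : restrict A v = v -> bd B v = bd A v.
Proof. by move=> Av; rewrite /bd rsBAC -/(bd C v) bdAC // addr0. Qed.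

Let suppA i (v : 'rV[K]_(r i)) : restrict B v = v -> restrict C v = 0 -> restrict A v = v.
Proof. by move=> Bv Cv; rewrite -[RHS]Bv rsBAC Cv addr0. Qed.

Let restrictC_A i (v : 'rV[K]_(r i)) : restrict A v = v -> restrict C v = 0.
Proof.
move=> <-; apply/rowP=> j; rewrite !mxE.
by case: (boolP (A j)) => [/AC0/negbTE->|_] //; case: (C j).
Qed.

Let bdCB i (v : 'rV[K]_(r i.+1)) : restrict C (bd B v) = bd C v.
Proof. exact: rsCB. Qed.

Let restrict_bdB i (v : 'rV[K]_(r i.+1)) : restrict B (bd B v) = bd B v.
Proof. exact: restrictK. Qed.

Let bdC_restrict i (v : 'rV[K]_(r i.+1)) :
  restrict B v = v -> bd C (restrict C v) = bd C v.
Proof.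
by move=> Bv; rewrite -[in RHS]Bv rsBAC bdD (@bdAC _ (restrict A v)) ?restrictK ?add0r.
Qed.

(** The image in [C] of a cycle [v] of [B] is a cycle; if [z] fills it, then v - dz lies in [A] and
    is a cycle there. *)
Lemma acyclic_mid i : acyclic_at A i -> acyclic_at C i -> acyclic_at B i.
Proof.
move=> HA HC v Bv dv.
have [|z [Cz dz]] := HC (restrict C v) (restrictK _ _).
  by rewrite bdC_restrict // -bdCB dv restrict0.
have Bz : restrict B z = z by rewrite -Cz rsBC.
have Ay : restrict A (v - bd B z) = v - bd B z.
  apply: suppA; first by rewrite restrictD restrictN restrict_bdB Bv.
  by rewrite restrictD restrictN bdCB dz subrr.
have [|w [Aw dw]] := HA _ Ay; first by rewrite -bdA // bdD bdN dv bdB2 // subr0.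
exists (z + w); split; first by rewrite restrictD Bz -Aw rsBA.
by rewrite bdD (bdA Aw) dw addrC subrK.
Qed.

(** If [z] in [B] fills a cycle of [A], its image in [C] is a cycle; subtracting the boundary of a
    filling [w] of that image moves [z] into [A]. *)
Lemma acyclic_sub i : acyclic_at C i.+1 -> acyclic_at B i -> acyclic_at A i.
Proof.
move=> HC HB v Av dv; have Bv : restrict B v = v by rewrite -Av rsBA.
have [|z [Bz dz]] := HB _ Bv; first by rewrite bdA.
have Cv := restrictC_A Av.
have [|w [Cw dw]] := HC (restrict C z) (restrictK _ _).
  by rewrite bdC_restrict // -bdCB dz.
have Bw : restrict B w = w by rewrite -Cw rsBC.
exists (z - bd B w).
have Ay : restrict A (z - bd B w) = z - bd B w.
  apply: suppA; first by rewrite restrictD restrictN restrict_bdB Bz.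
  by rewrite restrictD restrictN bdCB dw subrr.
by split=> //; rewrite -bdA // bdD bdN bdB2 // subr0.
Qed.

Lemma bd_quot_restrict i (v : 'rV[K]_(r i.+1)) :
  restrict B v = v -> bd C (restrict C v) = restrict C (bd B v).
Proof. by move=> Bv; rewrite bdC_restrict // bdCB. Qed.

(** The second hypothesis says that the homology of [A] injects into that of [B] one position lower.
    This also serves where [A] itself is not acyclic, as at F_0. *)
Lemma acyclic_quot_weak i : acyclic_at B i.+1 ->
    (forall v : 'rV[K]_(r i.+2), restrict B v = v -> restrict A (bd B v) = bd B v ->
       exists w : 'rV[K]_(r i.+2), restrict A w = w /\ bd A w = bd B v) ->
  acyclic_at C i.+1.
Proof.
move=> HB HA v Cv dv; have Bv : restrict B v = v by rewrite -Cv rsBC.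
have [|w [Aw dw]] := HA v Bv; first by apply: suppA; rewrite ?restrict_bdB // bdCB.
have Bw : restrict B w = w by rewrite -Aw rsBA.
have [||z [Bz dz]] := HB (v - w).
- by rewrite restrictD restrictN Bv Bw.
- by rewrite bdD bdN (bdA Aw) dw subrr.
exists (restrict C z); split; first exact: restrictK.
by rewrite bd_quot_restrict // dz restrictD restrictN Cv (restrictC_A Aw) subr0.
Qed.

Lemma acyclic_quot i : acyclic_at B i.+1 -> acyclic_at A i -> acyclic_at C i.+1.
Proof.
move=> HB HA; apply: acyclic_quot_weak => // v Bv Ax; apply: HA => //.
by rewrite -bdA // bdB2.
Qed.

End Subquotients.

(** * Multigraded matrices *)

Section GradedMatrices.
Variables (K : fieldType) (n : nat).
Local Notation S := {mpoly K[n]}.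
Implicit Types (b x : 'X_{1..n}).

(** A row over [K] supported on basis vectors of degree at most [b] encodes a homogeneous element of
    degree [b]: [lift_row] restores the monomials, and [coef_row] takes the degree [b] component of
    any element. *)
Definition bounded p (s : 'I_p -> 'X_{1..n}) b (v : 'rV[K]_p) :=
  forall j, v 0 j != 0 -> (s j <= b)%MM.

Definition lift_row p (s : 'I_p -> 'X_{1..n}) b (v : 'rV[K]_p) : 'rV[S]_p :=
  \row_j (v 0 j *: 'X_[b - s j]).

Definition coef_row p (s : 'I_p -> 'X_{1..n}) b (V : 'rV[S]_p) : 'rV[K]_p :=
  \row_j (if (s j <= b)%MM then (V 0 j)@_(b - s j) else 0).

Lemma lift_rowK p (s : 'I_p -> 'X_{1..n}) b v :
  bounded s b v -> coef_row s b (lift_row s b v) = v.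
Proof.
move=> bv; apply/rowP=> j; rewrite !mxE mcoeffZ mcoeffX eqxx mulr1.
by case: ifP => // /negbT; apply: contraNeq; rewrite eq_sym => /bv.
Qed.

Lemma coef_row_bounded p (s : 'I_p -> 'X_{1..n}) b V : bounded s b (coef_row s b V).
Proof. by move=> j; rewrite mxE; case: ifP => // _; rewrite eqxx. Qed.

Variables (p q : nat) (sp : 'I_p -> 'X_{1..n}) (sq : 'I_q -> 'X_{1..n}).
Variable M : 'M[S]_(p, q).
Hypothesis gradM : forall j l x, x \in msupp (M j l) -> (x + sq l)%MM = sp j.

Definition scalars : 'M[K]_(p, q) := \matrix_(j, l) (M j l)@_(sp j - sq l).

Lemma graded_entry j l : M j l = scalars j l *: 'X_[sp j - sq l].
Proof.
apply/mpolyP=> m; rewrite mcoeffZ mcoeffX mxE.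
case: eqVneq => [<-|ne]; first by rewrite mulr1.
rewrite mulr0; apply/eqP; rewrite mcoeff_eq0; apply: contra ne => /gradM <-.
by rewrite addmK.
Qed.

Lemma scalars_neq0 j l : scalars j l != 0 -> (sq l <= sp j)%MM.
Proof.
by rewrite mxE -mcoeff_msupp => /gradM <-; exact: lem_addl.
Qed.

Lemma bounded_mul b v : bounded sp b v -> bounded sq b (v *m scalars).
Proof.
move=> bv l; apply: contraR => nl; rewrite mxE big1 // => j _.
case: (eqVneq (v 0 j) 0) => [->|/bv jb]; first by rewrite mul0r.
case: (eqVneq (scalars j l) 0) => [->|/scalars_neq0 lj]; first by rewrite mulr0.
by rewrite (lepm_trans lj jb) in nl.
Qed.

Lemma lift_row_mul b v : bounded sp b v ->
  lift_row sp b v *m M = lift_row sq b (v *m scalars).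
Proof.
move=> bv; apply/rowP=> l; rewrite [RHS]mxE [(v *m _) 0 l]mxE !mxE scaler_suml.
apply: eq_bigr => j _; rewrite mxE graded_entry.
case: (eqVneq (v 0 j) 0) => [->|/bv jb]; first by rewrite !(mul0r, scale0r).
case: (eqVneq (scalars j l) 0) => [->|/scalars_neq0 lj].
  by rewrite !(mulr0, scale0r).
rewrite -scalerAl -scalerAr scalerA -mpolyXD; congr (_ *: 'X_[_]).
by apply/mnmP=> i; move/mnm_lepP/(_ i): lj; move/mnm_lepP/(_ i): jb; rewrite !mnmE; lia.
Qed.

(** [M] preserves degrees, so it commutes with taking the component of degree [b], even for an
    inhomogeneous row [V]. *)
Lemma coef_row_mul b V : coef_row sq b (V *m M) = coef_row sp b V *m scalars.
Proof.
have bd := bounded_mul (@coef_row_bounded _ sp b V).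
apply/rowP=> l; rewrite [LHS]mxE; case: ifPn => lb; last first.
  by apply/eqP; rewrite eq_sym; apply: contraR lb => /bd.
rewrite !mxE raddf_sum; apply: eq_bigr => j _ /=; rewrite mxE graded_entry -scalerAr mcoeffZ.
case: (eqVneq (scalars j l) 0) => [->|/scalars_neq0 lj]; first by rewrite mul0r mulr0.
case: ifPn => jb.
  rewrite mulrC; congr (_ * _).
  suff -> : (b - sq l = (sp j - sq l) + (b - sp j))%MM by rewrite mcoeffMX.
  by apply/mnmP=> i; move/mnm_lepP/(_ i): lj; move/mnm_lepP/(_ i): jb; rewrite !mnmE; lia.
rewrite mul0r; apply/eqP; rewrite mulf_eq0 mcoeff_eq0; apply/orP; right.
rewrite (perm_mem (msuppMX _ _)); apply: contra jb => /mapP [k _ e].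
apply/mnm_lepP=> i; move/mnmP/(_ i): e; move/mnm_lepP/(_ i): lj; move/mnm_lepP/(_ i): lb.
by rewrite !mnmE; lia.
Qed.

End GradedMatrices.

(** * Multigraded strands of a minimal resolution *)

Section Strands.
Variables (K : fieldType) (n : nat) (F : mgraded_complex K n) (I : set {mpoly K[n]}).
Local Notation S := {mpoly K[n]}.
Hypothesis grF : mgraded_maps F.
Hypothesis resF : resolves F I.
Hypothesis minF : minimal_complex F.
Implicit Types (b : 'X_{1..n}) (T : seq 'I_n).

(* Positions are shifted by one and a zero module is put in position 0, so that
   acyclic_at i refers to the homology at F_i. *)
Definition chain_rank i := if i is i'.+1 then mres_rank F i' else 0%N.

Definition chain_shift i : 'I_(chain_rank i) -> 'X_{1..n} :=
  match i with 0 => fun=> 0%MM | i'.+1 => fun j => @mres_shift K n F i' j end.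

Definition chain_diff i : 'M[K]_(chain_rank i.+1, chain_rank i) :=
  match i with
  | 0 => 0
  | i'.+1 => scalars (@mres_shift K n F i'.+1) (@mres_shift K n F i') (mres_diff F i')
  end.

Arguments chain_shift : simpl never.
Arguments chain_diff : simpl never.

(* The strand in degree b of the complex F / (x_p : p in T) F. *)
Definition strand T b i : pred 'I_(chain_rank i) :=
  fun j => (chain_shift j <= b)%MM && all (fun p => chain_shift j p == b p) T.

Local Notation acyclic T b i := (acyclic_at chain_diff (strand T b) i).

Lemma chain_diff_neq0 i j l :
  chain_diff i j l != 0 -> (chain_shift l <= chain_shift j)%MM.
Proof.
case: i j l => [|i] j l; first by case: l.
by apply: scalars_neq0 => {}j {}l x; case: grF => _; apply.
Qed.

Lemma mres_diff2 i : mres_diff F i.+1 *m mres_diff F i = 0.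
Proof.
apply/row_matrixP=> j; rewrite row0 row_mul rowE -mulmxA mulmxA.
case: resF => _ _ /(_ i) /(_ (delta_mx 0 j *m mres_diff F i.+1)) [_ H].
by apply: H; exists (delta_mx 0 j).
Qed.

(** Each basis vector is lifted to the free module in its own degree, where the composite over the
    polynomial ring vanishes. *)
Lemma chain_diff2 i : chain_diff i.+1 *m chain_diff i = 0.
Proof.
case: i => [|i]; first exact: mulmx0.
apply/row_matrixP=> j; rewrite row0 row_mul rowE -mulmxA mulmxA.
set b := @mres_shift K n F i.+2 j.
have gr i' j' l x : x \in msupp (mres_diff F i' j' l) ->
    (x + mres_shift l)%MM = mres_shift j' by case: grF => _; apply.
have bd : bounded (@mres_shift K n F i.+2) b (delta_mx 0 j : 'rV[K]_ _).
  move=> l; rewrite mxE eqxx /=; case: (eqVneq l j) => [-> _|]; last by rewrite eqxx.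
  exact: lepm_refl.
have bd1 := bounded_mul (gr i.+1) bd.
rewrite -[LHS](lift_rowK (bounded_mul (gr i) bd1)) -(lift_row_mul (gr i) bd1).
rewrite -(lift_row_mul (gr i.+1) bd) -mulmxA mres_diff2 mulmx0.
by apply/rowP=> l; rewrite !mxE mcoeff0 if_same.
Qed.

Lemma strand_bounded T b i (v : 'rV[K]_(chain_rank i)) :
  restrict (strand T b) v = v -> bounded (@chain_shift i) b v.
Proof. by move=> <- j; rewrite mxE; case: ifP => [/andP[]//|]; rewrite eqxx. Qed.

Lemma bounded_strand b i (v : 'rV[K]_(chain_rank i)) :
  bounded (@chain_shift i) b v -> restrict (strand [::] b) v = v.
Proof.
move=> bv; apply/rowP=> j; rewrite mxE /strand /= andbT.
by case: ifPn => // nb; apply/eqP; rewrite eq_sym; apply: contraR nb => /bv.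
Qed.

(** Truncation loses nothing: a basis vector on a path from [j] to [m] has its shift squeezed
    between theirs, so like them it agrees with [b] at the variables of [T]. *)
Lemma strand_bd2 T b i (v : 'rV[K]_(chain_rank i.+2)) :
    restrict (strand T b) v = v ->
  bd chain_diff (strand T b) (bd chain_diff (strand T b) v) = 0.
Proof.
move=> Bv; apply/rowP=> m; rewrite /bd mxE [RHS]mxE; case: ifP => // /andP[mb /allP mT].
have /rowP/(_ m) : v *m chain_diff i.+1 *m chain_diff i = 0.
  by rewrite -mulmxA chain_diff2 mulmx0.
rewrite [RHS]mxE => <-; rewrite mxE [RHS]mxE; apply: eq_bigr => l _.
case: (eqVneq (chain_diff i l m) 0) => [->|/chain_diff_neq0 ml]; first by rewrite !mulr0.
congr (_ * _); rewrite mxE; case: ifPn => // nl; rewrite mxE big1 // => j _.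
rewrite -Bv mxE; case: ifP => [/andP[jb jT]|]; last by rewrite mul0r.
case: (eqVneq (chain_diff i.+1 j l) 0) => [->|/chain_diff_neq0 lj]; first by rewrite mulr0.
case/negP: nl; rewrite /strand (lepm_trans lj jb) /=; apply/allP => p pT.
move/allP/(_ p pT)/eqP: jT => jp; move/eqP: (mT p pT) => mp; apply/eqP; move: mp jp.
move/mnm_lepP/(_ p): lj; move/mnm_lepP/(_ p): ml; lia.
Qed.

(** * The short exact sequence given by multiplication by one variable *)

Section Triple.
Variables (p : 'I_n) (T : seq 'I_n) (b : 'X_{1..n}).
Hypotheses (bp : (0 < b p)%N) (pT : p \notin T).

(** Multiplication by x_p embeds the strand of degree b - e_p: its basis vectors are those of the
    strand of degree [b] with shift below [b] at [p]. Equality at [p] singles out the cokernel. *)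
Lemma strand_triple_cover i (j : 'I_(chain_rank i)) :
  strand T b j = strand T (b - U_(p)) j || strand (p :: T) b j.
Proof.
have TE : all (fun q => chain_shift j q == (b - U_(p))%MM q) T =
          all (fun q => chain_shift j q == b q) T.
  apply: eq_in_all => q qT; rewrite mnmBE mnm1E.
  by case: (eqVneq p q) => [e|_]; [rewrite -e (negbTE pT) in qT | rewrite subn0].
rewrite /strand TE /=; case: (all _ T); last by rewrite !andbF.
rewrite !andbT; apply/idP/orP => [jb|[jb|/andP[]//]]; last first.
  by apply: lepm_trans jb (lem_subr _ _).
case: (eqVneq (chain_shift j p) (b p)) => jp; [by right; rewrite jb|left].
apply/mnm_lepP=> q; rewrite mnmBE mnm1E; move/mnm_lepP/(_ q): jb.
by case: (eqVneq p q) jp => [<-|]; lia.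
Qed.

Lemma strand_triple_disjoint i (j : 'I_(chain_rank i)) :
  strand T (b - U_(p)) j -> ~~ strand (p :: T) b j.
Proof.
case/andP=> /mnm_lepP/(_ p); rewrite mnmBE mnm1E eqxx => jp _.
by apply/negP => /andP[_ /andP[/eqP]]; lia.
Qed.

Lemma strand_triple_closed i j (l : 'I_(chain_rank i)) : chain_diff i j l != 0 ->
  strand T (b - U_(p)) j -> strand T b l -> strand T (b - U_(p)) l.
Proof.
move=> /chain_diff_neq0 lj /andP[jb _] lT; move: (lT); rewrite strand_triple_cover.
case/orP=> // /andP[_ /andP[/eqP e _]].
move/mnm_lepP/(_ p): jb; move/mnm_lepP/(_ p): lj; rewrite mnmBE mnm1E eqxx; lia.
Qed.

Lemma strand_acyclic_mid i :
  acyclic T (b - U_(p)) i -> acyclic (p :: T) b i -> acyclic T b i.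
Proof.
exact: (acyclic_mid strand_triple_cover strand_triple_disjoint strand_triple_closed
          (@strand_bd2 T b)).
Qed.

Lemma strand_acyclic_sub i :
  acyclic (p :: T) b i.+1 -> acyclic T b i -> acyclic T (b - U_(p)) i.
Proof.
exact: (acyclic_sub strand_triple_cover strand_triple_disjoint strand_triple_closed
          (@strand_bd2 T b)).
Qed.

Lemma strand_acyclic_quot i :
  acyclic T b i.+1 -> acyclic T (b - U_(p)) i -> acyclic (p :: T) b i.+1.
Proof.
exact: (acyclic_quot strand_triple_cover strand_triple_disjoint strand_triple_closed
          (@strand_bd2 T b)).
Qed.

(** At F_0 every chain is a cycle, so acyclicity means that all chains are boundaries, and this
    passes to quotients. *)
Lemma strand_acyclic_quot0 : acyclic T b 0 -> acyclic (p :: T) b 0.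
Proof.
move=> HB v Cv _.
have CB i (j : 'I_(chain_rank i)) : strand (p :: T) b j -> strand T b j.
  by rewrite strand_triple_cover => ->; rewrite orbT.
have [||z [Bz dz]] := HB v.
- apply/rowP=> j; rewrite -Cv !mxE; case: (boolP (strand (p :: T) b j)) => [/CB->|] //.
  by rewrite if_same.
- by apply/rowP; case.
exists (restrict (strand (p :: T) b) z); split; first exact: restrictK.
rewrite (bd_quot_restrict strand_triple_cover strand_triple_disjoint strand_triple_closed) //.
by rewrite dz.
Qed.

Lemma strand_acyclic_quot_weak i : acyclic T b i.+1 ->
    (forall v : 'rV[K]_(chain_rank i.+2), restrict (strand T b) v = v ->
       restrict (strand T (b - U_(p))) (bd chain_diff (strand T b) v) =
         bd chain_diff (strand T b) v ->
       exists w : 'rV[K]_(chain_rank i.+2), restrict (strand T (b - U_(p))) w = w /\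
         bd chain_diff (strand T (b - U_(p))) w = bd chain_diff (strand T b) v) ->
  acyclic (p :: T) b i.+1.
Proof.
exact: (acyclic_quot_weak strand_triple_cover strand_triple_disjoint strand_triple_closed).
Qed.

Lemma strand_quot_restrict i (v : 'rV[K]_(chain_rank i.+1)) :
  restrict (strand T b) v = v ->
  bd chain_diff (strand (p :: T) b) (restrict (strand (p :: T) b) v) =
    restrict (strand (p :: T) b) (bd chain_diff (strand T b) v).
Proof.
exact: (bd_quot_restrict strand_triple_cover strand_triple_disjoint strand_triple_closed).
Qed.

Lemma strand_sub_restrict i (v : 'rV[K]_(chain_rank i)) : restrict (strand T b) v = v ->
  restrict (strand (p :: T) b) v = 0 <-> restrict (strand T (b - U_(p))) v = v.
Proof.
move=> Bv; split=> [Cv|Av]; apply/rowP=> j; rewrite !mxE.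
  move/rowP/(_ j): Cv; move/rowP/(_ j): Bv; rewrite !mxE strand_triple_cover.
  by case: (strand T (b - _) j) => //=; case: (strand _ b j) => // _ ->.
move/rowP/(_ j): Av; rewrite !mxE.
by case: (boolP (strand T (b - _) j)) => [/strand_triple_disjoint/negbTE->|_ <-] //; rewrite if_same.
Qed.

End Triple.

Lemma bd_nil b i (v : 'rV[K]_(chain_rank i.+1)) :
  bounded (@chain_shift i.+1) b v -> bd chain_diff (strand [::] b) v = v *m chain_diff i.
Proof.
move=> bv; apply: bounded_strand => l; apply: contraR => nl; rewrite mxE big1 // => j _.
case: (eqVneq (v 0 j) 0) => [->|/bv jb]; first by rewrite mul0r.
case: (eqVneq (chain_diff i j l) 0) => [->|/chain_diff_neq0 lj]; first by rewrite mulr0.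
by rewrite (lepm_trans lj jb) in nl.
Qed.

Let grD i j l x : x \in msupp (mres_diff F i j l) ->
  (x + mres_shift l)%MM = mres_shift j.
Proof. by case: grF => _; apply. Qed.

Let grA j (l : 'I_1) x : x \in msupp (mres_aug F j l) -> (x + 0)%MM = mres_shift j.
Proof. by rewrite (ord1 l) addm0; case: grF => H _; apply: H. Qed.

Lemma strand_nil_acyclic b i : acyclic [::] b i.+1.
Proof.
move=> v Bv; have bv := strand_bounded Bv; rewrite bd_nil // => dv.
have : lift_row (@mres_shift K n F i.+1) b v *m mres_diff F i = 0.
  by rewrite (lift_row_mul (@grD i) bv) dv; apply/rowP=> l; rewrite !mxE scale0r.
case: resF => _ _ H /H [W /(congr1 (coef_row (@mres_shift K n F i.+1) b))].
rewrite (lift_rowK bv) (coef_row_mul (@grD i.+1)) => ->.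
have bw := @coef_row_bounded K n _ (@mres_shift K n F i.+2) b W.
by exists (coef_row (@mres_shift K n F i.+2) b W); rewrite bounded_strand // bd_nil.
Qed.

Definition chain_aug : 'cV[K]_(chain_rank 1) :=
  scalars (@mres_shift K n F 0) (fun=> 0%MM) (mres_aug F).

Lemma chain_aug_exact b (v : 'rV[K]_(chain_rank 1)) :
    bounded (@chain_shift 1) b v -> v *m chain_aug = 0 ->
  exists2 w : 'rV[K]_(chain_rank 2), bounded (@chain_shift 2) b w & w *m chain_diff 1 = v.
Proof.
move=> bv ev.
have : lift_row (@mres_shift K n F 0) b v *m mres_aug F = 0.
  by rewrite (lift_row_mul grA bv) ev; apply/rowP=> l; rewrite !mxE scale0r.
case: resF => _ H _ /H [W /(congr1 (coef_row (@mres_shift K n F 0) b))].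
rewrite (lift_rowK bv) (coef_row_mul (@grD 0)) => ->.
by exists (coef_row (@mres_shift K n F 1) b W) => //; exact: coef_row_bounded.
Qed.

Lemma chain_diff_aug : chain_diff 1 *m chain_aug = 0.
Proof.
apply/row_matrixP=> j; rewrite row0 row_mul rowE -mulmxA mulmxA.
set b := @mres_shift K n F 1 j.
have bd : bounded (@mres_shift K n F 1) b (delta_mx 0 j : 'rV[K]_ _).
  move=> l; rewrite mxE eqxx /=; case: (eqVneq l j) => [-> _|]; last by rewrite eqxx.
  exact: lepm_refl.
have bd1 := bounded_mul (@grD 0) bd.
rewrite -[LHS](lift_rowK (bounded_mul grA bd1)) -(lift_row_mul grA bd1).
rewrite -(lift_row_mul (@grD 0) bd) -mulmxA.
have -> : mres_diff F 0 *m mres_aug F = 0.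
  apply/row_matrixP=> k; rewrite row0 row_mul rowE.
  case: resF => _ /(_ (delta_mx 0 k *m mres_diff F 0)) [_ H] _.
  by apply: H; exists (delta_mx 0 k).
by rewrite mulmx0; apply/rowP=> l; rewrite !mxE mcoeff0 if_same.
Qed.

Lemma chain_aug_mem b (v : 'rV[K]_(chain_rank 1)) :
  bounded (@chain_shift 1) b v -> v *m chain_aug != 0 -> I 'X_[b].
Proof.
move=> bv ev; case: resF => <- _ _.
have c0 : (v *m chain_aug) 0 0 != 0.
  by apply: contra ev => /eqP e; apply/eqP/rowP=> i; rewrite (ord1 i) e mxE.
exists (((v *m chain_aug) 0 0)^-1%:MP *: lift_row (@mres_shift K n F 0) b v) => //.
rewrite -scalemxAl (lift_row_mul grA bv) !mxE subm0 mul_mpolyC scalerA.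
by move: c0; rewrite mxE => c0; rewrite mulVf // scale1r.
Qed.

Lemma chain_aug_surj b : I 'X_[b] ->
  exists2 v : 'rV[K]_(chain_rank 1), bounded (@chain_shift 1) b v & v *m chain_aug = 1.
Proof.
case: resF => <- _ _ [V _ /= eV].
exists (coef_row (@mres_shift K n F 0) b V); first exact: coef_row_bounded.
rewrite -(coef_row_mul grA); apply/rowP=> i; rewrite (ord1 i) mxE eV subm0 mcoeffX !mxE eqxx.
by rewrite ifT //; apply/mnm_lepP=> k; rewrite mnm0E.
Qed.

(** In degree [b] the homology at F_0 is the component I_b. *)
Lemma strand_nil_acyclic0 b : acyclic [::] b 0 <-> ~ I 'X_[b].
Proof.
split=> [aC /chain_aug_surj[v bv ev]|nI v Bv _]; last first.
  have bv := strand_bounded Bv; case: (eqVneq (v *m chain_aug) 0) => [ev|/(chain_aug_mem bv)/nI//].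
  by have [w bw dw] := chain_aug_exact bv ev; exists w; rewrite bounded_strand // bd_nil.
have [||w [Bw dw]] := aC v.
- exact: bounded_strand.
- by apply/rowP; case.
have := oner_neq0 'M[K]_1; rewrite -ev -dw bd_nil; last exact: strand_bounded Bw.
by rewrite -mulmxA chain_diff_aug mulmx0 eqxx.
Qed.

(** The delicate case is F_1. There the injectivity of multiplication by x_m from I_(b-e_m) to I_b
    is used; the augmentation detects it, having the same scalars in both degrees. *)
Lemma strand1_acyclicS b m i : (0 < b m)%N -> acyclic [:: m] b i.+1.
Proof.
move=> bm; case: i => [|i]; last by apply: strand_acyclic_quot => //; exact: strand_nil_acyclic.
apply: strand_acyclic_quot_weak => //; first exact: strand_nil_acyclic.
move=> v Bv; have bv := strand_bounded Bv; rewrite bd_nil // => Ax.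
have [|w bw dw] := @chain_aug_exact _ _ (strand_bounded Ax).
  by rewrite -mulmxA chain_diff_aug mulmx0.
by exists w; rewrite bounded_strand // bd_nil.
Qed.

(** The homology at F_0 is here the degree [b] part of I / x_m I. *)
Lemma strand1_acyclic0 b m : (0 < b m)%N ->
  acyclic [:: m] b 0 <-> ~ (I 'X_[b] /\ ~ I 'X_[b - U_(m)]).
Proof.
move=> bm; pose C := strand [:: m] b.
have bdC0 (w : 'rV[K]_(chain_rank 2)) : bounded (@chain_shift 2) b w ->
    bd chain_diff C (restrict C w) = restrict C (w *m chain_diff 1).
  by move=> bw; rewrite strand_quot_restrict ?bounded_strand // bd_nil.
split=> [aC [Ib nIb]|nI].
  have [v bv ev] := chain_aug_surj Ib.
  have [|w [Cw dw]] := aC (restrict C v) (restrictK _ _).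
    by apply/rowP; case.
  (* A filling [w] of the image of [v] makes [y] an element of degree b - e_m with augmentation 1,
     so x^(b-e_m) would lie in [I]. *)
  have bw := strand_bounded Cw; pose y := v - w *m chain_diff 1.
  have bwd : restrict (strand [::] b) (w *m chain_diff 1) = w *m chain_diff 1.
    by rewrite -(bd_nil bw) /bd restrictK.
  have By : restrict (strand [::] b) y = y.
    by rewrite restrictD restrictN bounded_strand // bwd.
  have Cy : restrict C y = 0.
    by rewrite restrictD restrictN -bdC0 // Cw dw subrr.
  case: nIb; apply: (@chain_aug_mem _ y).
    by apply: strand_bounded; apply/(strand_sub_restrict bm _ By).
  by rewrite mulmxBl ev -mulmxA chain_diff_aug mulmx0 subr0 oner_neq0.
move=> v Cv _; have bv := strand_bounded Cv.
suff [y [by_ ey Cy]] : exists y : 'rV[K]_(chain_rank 1),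
    [/\ bounded (@chain_shift 1) b y, y *m chain_aug = 0 & restrict C y = v].
  have [w bw dw] := chain_aug_exact by_ ey.
  by exists (restrict C w); rewrite restrictK bdC0 // dw.
case: (eqVneq (v *m chain_aug) 0) => [ev|nev]; first by exists v.
have [|Ibm] := pselect (I 'X_[b - U_(m)]); last by case: nI; split=> //; exact: chain_aug_mem nev.
case/chain_aug_surj=> z bz ez.
have Bz : restrict (strand [::] b) z = z.
  by apply: bounded_strand => j /bz jz; apply: lepm_trans jz (lem_subr _ _).
(* [z] has degree b - e_m and augmentation 1: the correction kills the augmentation and is invisible
   modulo x_m. *)
exists (v - v *m chain_aug *m z); split.
- move=> j; rewrite !mxE; case: (eqVneq (v 0 j) 0) => [->|/bv //].
  rewrite sub0r oppr_eq0 big_ord1 mulf_eq0 negb_or => /andP[_ /bz jz].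
  exact: lepm_trans jz (lem_subr _ _).
- by rewrite mulmxBl -[_ *m z *m _]mulmxA ez mulmx1 subrr.
apply/rowP=> j; rewrite !mxE big_ord1; have /rowP/(_ j) := Cv; rewrite mxE -/C.
have : restrict C z = 0 by apply/(strand_sub_restrict bm _ Bz); rewrite ?bounded_strand.
move/rowP/(_ j); rewrite !mxE -/C; case: ifP => // _ -> _; by rewrite mulr0 subr0.
Qed.

(* When T contains the support of a, the strand has zero differential and its
   basis is indexed by the generators of degree exactly a. *)
Lemma strand_full_acyclic T (a : 'X_{1..n}) i : (forall p, (a p != 0%N) -> p \in T) ->
  acyclic T a i <-> ~ exists j : 'I_(mres_rank F i), mres_shift j = a.
Proof.
move=> aT.
have strandE i' (j : 'I_(chain_rank i')) : strand T a j = (chain_shift j == a).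
  apply/idP/eqP => [/andP[/mnm_lepP ja /allP jT]|e]; last first.
    by rewrite /strand e lepm_refl; apply/allP => p _.
  apply/mnmP=> p; case: (eqVneq (a p) 0%N) => [ap|/aT pT]; last exact/eqP/(jT p).
  by move: (ja p); rewrite ap leqn0 => /eqP.
split=> [aC [j ja]|nj v Tv _]; last first.
  exists 0; rewrite restrict0 /bd mul0mx restrict0; split=> //; apply/rowP=> j.
  by rewrite -Tv !mxE strandE; case: eqP => // ja; case: nj; exists j.
(* Between basis vectors of equal degree the scalar is a constant term, and minimality makes it
   0. *)
have bd0 i' (v : 'rV[K]_(chain_rank i'.+1)) :
    restrict (strand T a) v = v -> bd chain_diff (strand T a) v = 0.
  move=> Tv; apply/rowP=> l; rewrite mxE [RHS]mxE strandE; case: eqP => // la.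
  rewrite mxE big1 // => k _; rewrite -Tv mxE strandE.
  case: eqP => [ka|]; last by rewrite mul0r.
  case: i' v k l Tv la ka => [|i'] v k l _ la ka; first by case: l la.
  rewrite [chain_diff _ _ _]mxE; move: la ka; rewrite /chain_shift => -> ->.
  have -> : (a - a = 0)%MM by apply/mnmP=> p; rewrite !mnmE subnn.
  by rewrite irrelevant_mcoeff0 ?mulr0.
have Tj : restrict (strand T a) (delta_mx 0 j : 'rV[K]_(chain_rank i.+1)) = delta_mx 0 j.
  apply/rowP=> l; rewrite !mxE strandE eqxx /=.
  case: (eqVneq l j) => [->|_]; last by rewrite if_same.
  by rewrite /chain_shift ja eqxx.
have [w [Tw]] := aC _ Tj (bd0 _ _ Tj).
by rewrite bd0 // => /rowP/(_ j)/eqP; rewrite !mxE !eqxx eq_sym oner_eq0.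
Qed.

End Strands.

(** * Shifts in the resolution of a squarefree Borel ideal *)

Section BorelShifts.
Variables (K : fieldType) (n d : nat) (F : mgraded_complex K n) (I : set {mpoly K[n]}).
Variable G : set 'X_{1..n}.
Hypothesis grF : mgraded_maps F.
Hypothesis resF : resolves F I.
Hypothesis minF : minimal_complex F.
Hypothesis memI : forall b, I 'X_[b] <-> exists2 g, G g & (g <= b)%MM.
Hypothesis sqG : forall g, G g -> squarefree_mnm g.
Hypothesis degG : forall g, G g -> mdeg g = d.
Hypothesis borelG : forall g (i j : 'I_n), G g -> (i < j)%N -> g j != 0%N -> g i = 0%N ->
  G (g - U_(j) + U_(i))%MM.
Implicit Types (b : 'X_{1..n}) (T : seq 'I_n).

Local Notation acyclic T b i := (acyclic_at (@chain_diff K n F) (@strand K n F T b) i).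

(** The generators are squarefree, so x^b lies in [I] only if x^(b-e_p) does. Hence nothing survives
    modulo x_p, and dividing out the variables of [T] leaves the exponent of x_p alone. *)
Lemma nonsquarefree_acyclic p T b i : (1 < b p)%N -> uniq (rcons T p) ->
  (forall q, q \in T -> b q != 0%N) -> acyclic (rcons T p) b i.
Proof.
elim: T b i => [|q T IH] b i bp /=.
  have bp0 : (0 < b p)%N by lia.
  move=> _ _; case: i => [|i]; last exact: (strand1_acyclicS grF resF).
  apply/(strand1_acyclic0 grF resF bp0) => -[/memI[g Gg gb] []]; apply/memI; exists g => //.
  apply/mnm_lepP=> q; rewrite mnmBE mnm1E; move/mnm_lepP/(_ q): gb; have := sqG Gg q.
  by case: (eqVneq p q) bp => [->|]; lia.
move=> /andP[qT uT] Tb.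
have bq : (0 < b q)%N by rewrite lt0n Tb ?mem_head.
have {}Tb q' : q' \in T -> b q' != 0%N by move=> q'T; rewrite Tb // inE q'T orbT.
case: i => [|i]; first by apply: (strand_acyclic_quot0 grF) => //; apply: IH.
apply: (strand_acyclic_quot grF resF) => //; first exact: IH.
move: qT; rewrite mem_rcons inE negb_or => /andP[qp qT].
apply: IH => //; first by rewrite mnmBE mnm1E (negbTE qp) subn0.
move=> q' q'T; rewrite mnmBE mnm1E; case: (eqVneq q q') => [e|_]; last by rewrite subn0 Tb.
by rewrite e q'T in qT.
Qed.

(** The criterion for a partial list [T]: variables of [b] not yet divided out must occur in [g].
    Once [rcons T m] contains the support of [b], the last condition is empty. *)
Definition has_generator_with_top T m b :=
  exists g, [/\ G g, (g <= b)%MM, g m != 0%N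
              & forall p, b p != 0%N -> p \notin rcons T m -> g p != 0%N].

Lemma mdeg_subU b q : b q != 0%N -> (mdeg (b - U_(q))).+1 = mdeg b.
Proof.
move=> bq; rewrite -[in RHS](@submK _ U_(q) b) ?mdegD ?mdeg1 ?addn1 //.
by apply/mnm_lepP=> p; rewrite mnm1E; case: eqVneq => [<-|]; lia.
Qed.

Lemma mdeg_le_eq b g : (g <= b)%MM -> (mdeg b <= mdeg g)%N -> g = b.
Proof.
move=> gb; rewrite -(submK gb) mdegD => h.
have /eqP : mdeg (b - g) = 0%N by lia.
by rewrite mdeg_eq0 => /eqP->; rewrite add0m.
Qed.

(** If a generator [g] contains x_m and properly divides x^b, a variable x_j of [b] outside [g] has
    j < m, and exchanging [m] for [j] in [g] gives a generator dividing x^(b-e_m). *)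
Lemma minimal_generator b m : squarefree_mnm b -> b m != 0%N ->
    (forall q, b q != 0%N -> (q <= m)%N) ->
  I 'X_[b] /\ ~ I 'X_[b - U_(m)] <-> G b.
Proof.
move=> sb bm mb; split=> [[/memI[g Gg gb] nI]|Gb]; last first.
  split; first by apply/memI; exists b => //; exact: lepm_refl.
  case/memI=> g Gg gb; have := mdeg_subU bm; have := degG Gg; have := degG Gb.
  by move: gb => /submK <-; rewrite mdegD; lia.
have [e|ne] := eqVneq g b; first by rewrite -e.
have gm : g m != 0%N.
  apply/negP=> /eqP gm; apply: nI; apply/memI; exists g => //.
  by apply/mnm_lepP=> q; rewrite mnmBE mnm1E; move/mnm_lepP/(_ q): gb; case: (eqVneq m q) => [<-|]; lia.
have [j gj] : exists j, (g j < b j)%N.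
  apply/existsP; apply: contraNT ne => /existsPn H; apply/eqP/mnmP=> j.
  by move/mnm_lepP/(_ j): gb; have := H j; lia.
have := sb j; have bj : b j != 0%N by lia.
have jm : j != m by apply: contraTneq gj => ->; move: (sb m); lia.
have ltjm : (j < m)%N by rewrite ltn_neqAle jm mb.
move=> bj1; case: nI; apply/memI; exists (g - U_(m) + U_(j))%MM; first by apply: borelG => //; lia.
apply/mnm_lepP=> q; rewrite !mnmE; move/mnm_lepP/(_ q): gb.
case: (eqVneq m q) => [eq|]; case: (eqVneq j q) => [eq'|]; try lia; last by rewrite -eq'; lia.
by rewrite eq' eq eqxx in jm.
Qed.

(** Homology occurs only at index mdeg b - d, so each long exact sequence reduces to a short one:
    after adding [q] the homology is nonzero if and only if it was so for [T] in degree [b] or in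
    degree b - e_q. *)
Lemma squarefree_strands m T b : uniq (rcons T m) -> squarefree_mnm b -> b m != 0%N ->
    (forall q, b q != 0%N -> (q <= m)%N) -> (forall q, q \in T -> b q != 0%N) ->
  forall i, ((i + d)%N != mdeg b -> acyclic (rcons T m) b i) /\
            ((i + d)%N = mdeg b ->
               acyclic (rcons T m) b i <-> ~ has_generator_with_top T m b).
Proof.
elim: T b => [|q T IH] b uT sb bm mb Tb i.
  have bm0 : (0 < b m)%N by rewrite lt0n.
  case: i => [|i] /=; rewrite ?add0n.
    split=> e; rewrite (strand1_acyclic0 grF resF) ?minimal_generator //.
      by move=> /degG/eqP; rewrite eq_sym (negbTE e).
    suff -> : G b <-> has_generator_with_top [::] m b by [].
    split=> [Gb|[g [Gg gb _ _]]]; first by exists b; split=> //; exact: lepm_refl.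
    by rewrite -(mdeg_le_eq gb) // -e (degG Gg).
  split=> [_|e]; first exact: (strand1_acyclicS grF resF).
  split=> // [_ [g [Gg gb gm gT]]|_]; last exact: (strand1_acyclicS grF resF).
  (* With [T] empty every variable of [b] occurs in [g], so mdeg b would be at most [d]. *)
  have := mdeg_le_eq gb; rewrite (degG Gg) -e.
  have : (mdeg b <= mdeg g)%N; last by rewrite (degG Gg); lia.
  rewrite !mdegE; apply: leq_sum => p _; have := sb p.
  case: (eqVneq p m) => [->|pm]; first by move: gm; lia.
  by have := gT p; rewrite inE pm; case: (b p) => // b' /(_ isT isT); lia.
have bq : b q != 0%N by rewrite Tb ?mem_head.
have bq0 : (0 < b q)%N by rewrite lt0n.
move: uT => /= /andP[qT uT]; have := qT; rewrite mem_rcons inE negb_or => /andP[qm qT'].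
have Tb' q' : q' \in T -> b q' != 0%N by move=> q'T; rewrite Tb // inE q'T orbT.
have cE p : q != p -> (b - U_(q))%MM p = b p by move=> ne; rewrite mnmBE mnm1E (negbTE ne) subn0.
have c_le p : ((b - U_(q))%MM p <= b p)%N by rewrite mnmBE leq_subr.
have HB := IH b uT sb bm mb Tb'.
have HA : forall i, _ := IH (b - U_(q))%MM uT _ _ _ _.
have {}HA j : ((j + d)%N != (mdeg b).-1 -> acyclic (rcons T m) (b - U_(q)) j) /\
    ((j + d)%N = (mdeg b).-1 -> acyclic (rcons T m) (b - U_(q)) j <->
       ~ has_generator_with_top T m (b - U_(q))).
  rewrite -(mdeg_subU bq); apply: HA => [p||p|p pT].
  - exact: leq_trans (c_le p) (sb p).
  - by rewrite cE.
  - by move=> cp; apply: mb; have := c_le p; lia.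
  - by rewrite cE ?Tb' //; apply: contraNneq qT' => ->.
have := mdeg_subU bq => mb1; split=> [ne|e].
  case: i ne => [|i] ne; first by apply: (strand_acyclic_quot0 grF) => //; apply: (HB 0%N).1.
  by apply: (strand_acyclic_quot grF resF) => //; [apply: (HB i.+1).1 | apply: (HA i).1; lia].
(* The two alternatives correspond to whether [g] contains x_q. *)
have split_top : has_generator_with_top (q :: T) m b <->
    has_generator_with_top T m b \/ has_generator_with_top T m (b - U_(q)).
  split=> [[g [Gg gb gm gT]]|[|] [g [Gg gb gm gT]]].
  - case: (eqVneq (g q) 0%N) => gq; [right|left]; exists g; split=> //.
    + apply/mnm_lepP=> p; rewrite mnmBE mnm1E; move/mnm_lepP/(_ p): gb.
      by case: (eqVneq q p) => [<-|]; lia.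
    + move=> p cp pT; apply: gT; first by have := c_le p; lia.
      rewrite /= inE negb_or pT andbT; apply: contraNneq cp => ->.
      by rewrite mnmBE mnm1E eqxx; have := sb q; lia.
    + move=> p bp pT; case: (eqVneq p q) => [->//|pq]; apply: gT => //.
      by rewrite /= inE negb_or pq.
  - exists g; split=> // p bp; rewrite /= inE negb_or => /andP[_ pT]; exact: gT.
  - exists g; split=> //; first exact: lepm_trans gb (lem_subr _ _).
    move=> p bp; rewrite /= inE negb_or => /andP[pq pT]; apply: gT => //.
    by rewrite cE // eq_sym.
rewrite split_top; split=> [aC|nE].
  move=> [HE|HE].
    suff /((HB i).2 e) : acyclic (rcons T m) b i by [].
    by apply: (strand_acyclic_mid grF resF _ _ _ aC) => //; apply: (HA i).1; lia.
  case: i e aC => [|i] e aC.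
    (* Here mdeg b = d, so x^b / x_q has too small a degree to contain a generator. *)
    case: HE => g [Gg gb _ _]; have := degG Gg; move: gb => /submK gb.
    by have := congr1 mdeg gb; rewrite mdegD; lia.
  suff /((HA i).2 _) H : acyclic (rcons T m) (b - U_(q)) i by apply: H; first lia.
  by apply: (strand_acyclic_sub grF resF _ _ aC) => //; apply: (HB i).1; lia.
case: i e => [|i] e.
  by apply: (strand_acyclic_quot0 grF) => //; apply/((HB 0%N).2 e) => ?; apply: nE; left.
apply: (strand_acyclic_quot grF resF) => //; first by apply/((HB i.+1).2 e) => ?; apply: nE; left.
by apply/(HA i).2; [lia|move=> ?; apply: nE; right].
Qed.

(* The last condition says that g contains the largest variable of a; this form
   of it also covers a = 0. *)
Definition borel_shift k (a : 'X_{1..n}) :=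
  [/\ squarefree_mnm a, mdeg a = (d + k)%N & exists g, [/\ G g, (g <= a)%MM
    & forall p, a p != 0%N -> exists2 q : 'I_n, (p <= q)%N & g q != 0%N]].

(** When the list of variables contains the support of [a], the strand has homology exactly if some
    basis vector has degree [a]. The largest variable is divided out first. *)
Lemma shift_borel k (a : 'X_{1..n}) :
  (exists j : 'I_(mres_rank F k), mres_shift j = a) <-> borel_shift k a.
Proof.
have dec (T : seq 'I_n) : (forall p, a p != 0%N -> p \in T) ->
    (exists j : 'I_(mres_rank F k), mres_shift j = a) <-> ~ acyclic T a k.
  by move=> aT; rewrite (strand_full_acyclic minF) //; split=> [h nh|/contrapT//]; exact: nh.
have [/existsP[p ap]|/existsPn sa] := boolP [exists p, (1 < a p)%N].
  split=> [|[sa _ _]]; last by move: (sa p); lia.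
  pose T := [seq q <- enum 'I_n | (a q != 0%N) && (q != p)].
  have aT q : a q != 0%N -> q \in rcons T p.
    by move=> aq; rewrite mem_rcons inE mem_filter mem_enum aq; case: eqVneq.
  case/(dec _ aT); apply: nonsquarefree_acyclic => // [|q]; last first.
    by rewrite mem_filter => /andP[/andP[]].
  by rewrite rcons_uniq mem_filter eqxx andbF filter_uniq ?enum_uniq.
have {}sa : squarefree_mnm a by move=> p; have := sa p; lia.
(* The zero degree has no largest variable; the strand with nothing divided out already decides
   it. *)
have [a0|] := eqVneq a 0%MM.
  rewrite (dec [::]); last by move=> p; rewrite a0 mnm0E.
  case: k {dec} => [|k].
    rewrite (strand_nil_acyclic0 grF resF) a0; split=> [/contrapT/memI[g Gg g0]|[_ _ [g [Gg g0 _]]] []].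
      split=> //; first by move=> p; rewrite mnm0E.
      - rewrite mdeg0 addn0 -(degG Gg); apply/esym/eqP; rewrite mdeg_eq0; apply/eqP/mnmP => p.
        by move/mnm_lepP/(_ p): g0; rewrite mnm0E; lia.
      - by exists g; split=> // p; rewrite mnm0E.
    by apply/memI; exists g.
  split=> [[]|[_]]; first exact: (strand_nil_acyclic grF resF).
  by rewrite a0 mdeg0; lia.
move=> na; have [p0 ap0] : exists p, a p != 0%N.
  by apply/existsP; apply: contraNT na => /existsPn H; apply/eqP/mnmP=> p; rewrite mnm0E; have := H p; lia.
pose m := [arg max_(p > p0 | a p != 0%N) (p : nat)].
have [am ma] : a m != 0%N /\ forall q, a q != 0%N -> (q <= m)%N.
  by rewrite /m; case: arg_maxnP.
pose T := [seq q <- enum 'I_n | (a q != 0%N) && (q != m)].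
have aT q : a q != 0%N -> q \in rcons T m.
  by move=> aq; rewrite mem_rcons inE mem_filter mem_enum aq; case: eqVneq.
have uT : uniq (rcons T m) by rewrite rcons_uniq mem_filter eqxx andbF filter_uniq ?enum_uniq.
have Ta q : q \in T -> a q != 0%N by rewrite mem_filter => /andP[/andP[]].
have [H1 H2] := squarefree_strands uT sa am ma Ta k.
rewrite (dec _ aT); split=> [nac|[_ e [g [Gg ga ag]]]].
  have e : (k + d)%N = mdeg a by apply/eqP; apply: contrapT => /negP/H1.
  move: nac; rewrite (H2 e) => /contrapT[g [Gg ga gm _]]; split=> //; first by rewrite addnC.
  by exists g; split=> // p /ma pm; exists m.
rewrite H2; last by rewrite addnC.
apply; exists g; split=> // [|p /aT->//].
have [q mq gq] := ag m am.
suff -> : m = q by [].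
apply/val_inj/anti_leq; rewrite mq ma //=.
by move/mnm_lepP/(_ q): ga; lia.
Qed.

End BorelShifts.

(** * Borel exchanges *)

Lemma monomial_ideal_mem (K : fieldType) n (G : set 'X_{1..n}) (f : {mpoly K[n]}) :
  ideal_gen [set 'X_[g] | g in G] f ->
  forall m, m \in msupp f -> exists2 g, G g & (g <= m)%MM.
Proof.
move=> Gf; pose P (h : {mpoly K[n]}) := forall m, m \in msupp h -> exists2 g, G g & (g <= m)%MM.
refine (Gf [set h | P h] _); split; last first.
  by move=> _ [g Gg <-] m; rewrite msuppX inE => /eqP ->; exists g => //; exact: lepm_refl.
split=> /= [m|x y Px Py m /msuppD_le|a x Px m /msuppM_le].
- by rewrite msupp0.
- by rewrite mem_cat => /orP[/Px|/Py].
- case/allpairsP => -[m1 m2] /= [_ /Px[g Gg gm] ->]; exists g => //.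
  exact: lepm_trans gm (lem_addl _ _).
Qed.

Lemma monomial_ideal_geq (K : fieldType) n (I : set {mpoly K[n]}) (g b : 'X_{1..n}) :
  is_ideal I -> I 'X_[g] -> (g <= b)%MM -> I 'X_[b].
Proof. by move=> [_ _ IM] Ig /submK <-; rewrite mpolyXD; exact: IM. Qed.

Section B1.
Variables (K : fieldType) (n m d : nat) (u : 'I_m -> 'X_{1..n}).
Hypothesis sqfree_u : forall i, squarefree_mnm (u i).
Hypothesis deg_u : forall i, mdeg (u i) = d.

Definition B1_generator : set 'X_{1..n} :=
  [set g | [/\ squarefree_mnm g, mdeg g = d & B1 K u 'X_[g]]].

Lemma mdeg_exchange (g : 'X_{1..n}) (i j : 'I_n) : g j != 0%N ->
  mdeg (g - U_(j) + U_(i))%MM = mdeg g.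
Proof. by move=> gj; rewrite mdegD mdeg1 addn1 mdeg_subU. Qed.

Lemma squarefree_exchange (g : 'X_{1..n}) (i j : 'I_n) : squarefree_mnm g -> g i = 0%N ->
  squarefree_mnm (g - U_(j) + U_(i))%MM.
Proof.
move=> sg gi p; rewrite !mnmE; have := sg p.
by case: (eqVneq i p) => [<-|_]; rewrite ?gi; lia.
Qed.

Lemma B1_generator_borel g (i j : 'I_n) : B1_generator g -> (i < j)%N -> g j != 0%N ->
  g i = 0%N -> B1_generator (g - U_(j) + U_(i))%MM.
Proof.
move=> [sg dg Bg] ij gj gi; split; first exact: squarefree_exchange.
  by rewrite mdeg_exchange.
move=> A [bA uA]; apply: (bA.2 g) => //; last exact: squarefree_exchange.
exact: Bg.
Qed.

(** The squarefree monomials of degree [d] in the ideal generate a squarefree Borel ideal containing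
    all u_i, so minimality gives equality. For the Borel property, a generator dividing x^w either
    misses x_j and still divides x^v, or is exchanged along with [w]. *)
Lemma B1_mem b : B1 K u 'X_[b] <-> exists2 g, B1_generator g & (g <= b)%MM.
Proof.
split=> [Bb|[g [_ _ Bg] gb] A [bA uA]]; last first.
  apply: monomial_ideal_geq gb; last exact: Bg.
  by case: bA => -[H [_ ->]] _; exact: ideal_genP.
have H : squarefree_borel (ideal_gen [set 'X_[K, g] | g in B1_generator]).
  split; first by exists B1_generator; split=> // g [].
  move=> w i j sw Iw wj ij v sv.
  have [|g Gg gw] := monomial_ideal_mem Iw (m := w); first by rewrite msuppX inE.
  have gI h : B1_generator h -> ideal_gen [set 'X_[K, g] | g in B1_generator] 'X_[h].
    by move=> Gh J [_ GJ]; apply: GJ; exists h.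
  have nij : i != j by rewrite neq_ltn ij.
  have wi : w i = 0%N.
    by have := sv i; rewrite /v !mnmE eqxx eq_sym (negbTE nij); lia.
  case: (eqVneq (g j) 0%N) => gj.
    apply: monomial_ideal_geq (ideal_genP _) (gI _ Gg) _.
    apply/mnm_lepP=> p; rewrite /v !mnmE; move/mnm_lepP/(_ p): gw.
    by case: (eqVneq j p) => [<-|_]; lia.
  have gi : g i = 0%N by move/mnm_lepP/(_ i): gw; lia.
  apply: monomial_ideal_geq (ideal_genP _) (gI _ (B1_generator_borel Gg ij gj gi)) _.
  by apply/mnm_lepP=> p; rewrite /v !mnmE; move/mnm_lepP/(_ p): gw; lia.
have : ideal_gen [set 'X_[K, g] | g in B1_generator] 'X_[b].
  apply: Bb; split=> // _ [i _ <-] J [_ GJ]; apply: GJ; exists (u i) => //.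
  split=> // A [_ uA]; apply: uA; by exists i.
by move/monomial_ideal_mem/(_ b); apply; rewrite msuppX inE.
Qed.

End B1.

Section BorelExchange.
Variables (n d : nat) (G : set 'X_{1..n}).
Hypothesis degG : forall g, G g -> mdeg g = d.
Hypothesis borelG : forall g (i j : 'I_n), G g -> (i < j)%N -> g j != 0%N -> g i = 0%N ->
  G (g - U_(j) + U_(i))%MM.

(** If [g] misses x_j it is kept. Otherwise [j] is replaced in [g] by [i] or, if the result does not
    reach the largest variable [m] of the new monomial, by [m]. *)
Lemma borel_shift_exchange k w (i j : 'I_n) : borel_shift d G k w -> (i < j)%N ->
  w j != 0%N -> w i = 0%N -> borel_shift d G k (w - U_(j) + U_(i))%MM.
Proof.
move=> [sw dw [g [Gg gw gtop]]] ij wj wi; split.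
- exact: squarefree_exchange.
- by rewrite mdeg_exchange.
set w' := (w - U_(j) + U_(i))%MM.
have nij : i != j by rewrite neq_ltn ij.
have w'E p : w' p = if p == i then 1%N else if p == j then 0%N else w p.
  rewrite !mnmE (eq_sym i p) (eq_sym j p); case: (eqVneq p i) => [->|_].
    by rewrite wi (negbTE nij).
  by have := sw j; case: (eqVneq p j) => [->|_]; lia.
clearbody w'.
have gi : g i = 0%N by move/mnm_lepP/(_ i): gw; lia.
case: (eqVneq (g j) 0%N) => gj.
  exists g; split=> //.
    apply/mnm_lepP=> p; rewrite w'E; move/mnm_lepP/(_ p): gw.
    by case: (eqVneq p i) => [->|_]; [|case: (eqVneq p j) => [->|_]]; lia.
  move=> p; rewrite w'E; case: (eqVneq p i) => [-> _|pi].
    by have [q jq gq] := gtop j wj; exists q => //; exact: leq_trans (ltnW ij) jq.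
  by case: (eqVneq p j) => // _; exact: gtop.
have g_le (l : 'I_n) : w' l != 0%N -> g l = 0%N -> (g - U_(j) + U_(l) <= w')%MM.
  move=> w'l gl; have lj : l != j by apply: contraNneq gj => <-; rewrite gl.
  apply/mnm_lepP=> p; rewrite !mnmE; have := sw j; move/mnm_lepP/(_ p): gw.
  case: (eqVneq l p) => [<-|_]; first by rewrite gl; lia.
  rewrite w'E; case: (eqVneq j p) => [<-|jp]; last by case: (eqVneq p i) => [->|_]; lia.
  by lia.
have w'i : w' i != 0%N by rewrite w'E eqxx.
pose m := [arg max_(p > i | w' p != 0%N) (p : nat)].
have [w'm mmax] : w' m != 0%N /\ forall q, w' q != 0%N -> (q <= m)%N.
  by rewrite /m; case: arg_maxnP.
have [/existsP[q /andP[mq q'0]]|/existsPn nq] :=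
    boolP [exists q : 'I_n, (m <= q)%N && ((g - U_(j) + U_(i))%MM q != 0%N)].
  exists (g - U_(j) + U_(i))%MM; split; [exact: borelG|exact: g_le|].
  by move=> p /mmax pm; exists q => //; exact: leq_trans mq.
have gm : g m = 0%N.
  have := nq m; rewrite leqnn negbK /= !mnmE.
  have := w'm; rewrite w'E; case: (eqVneq i m) => [<- //|_].
  by rewrite (eq_sym j); case: (eqVneq m j) => //; lia.
(* Unless m = i, some variable of [g] is at or above [m]; it does not survive the exchange with [i],
   so it is x_j. *)
have mj : (m < j)%N.
  have mj : m != j.
    by apply: contraNneq w'm => ->; rewrite w'E eqxx (eq_sym j i) (negbTE nij).
  have [->|mi] := eqVneq m i; first exact: ij.
  have wm : w m != 0%N by move: w'm; rewrite w'E (negbTE mi) (negbTE mj).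
  have [q mq gq] := gtop m wm.
  have := nq q; rewrite mq /= negbK !mnmE; case: (eqVneq j q) => [e _|_]; last by lia.
  by rewrite ltn_neqAle mj e.
exists (g - U_(j) + U_(m))%MM; split; [exact: borelG|exact: g_le|].
by move=> p /mmax pm; exists m => //; rewrite !mnmE eqxx; lia.
Qed.

Lemma borel_shift_remove k w g (c : 'I_n) : squarefree_mnm w -> mdeg w = (d + k.+1)%N ->
    G g -> (g <= w)%MM ->
    (forall p, w p != 0%N -> exists2 q : 'I_n, (p <= q)%N & g q != 0%N) ->
  w c != 0%N -> g c = 0%N -> borel_shift d G k (w - U_(c))%MM.
Proof.
move=> sw dw Gg gw gtop wc gc; split.
- by move=> p; rewrite mnmBE; have := sw p; lia.
- by have := mdeg_subU wc; rewrite dw; lia.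
exists g; split=> //; last by move=> p; rewrite mnmBE => wp; apply: gtop; lia.
apply/mnm_lepP=> p; rewrite mnmBE mnm1E; move/mnm_lepP/(_ p): gw.
by case: (eqVneq c p) => [<-|]; lia.
Qed.

Lemma mdeg_lt_ex (g w : 'X_{1..n}) : (mdeg g < mdeg w)%N -> exists p, (g p < w p)%N.
Proof.
move=> lt; apply/existsP; apply: contraTT lt => /existsPn H.
by rewrite -leqNgt !mdegE; apply: leq_sum => p _; have := H p; lia.
Qed.

(** The degrees leave a variable of [w] outside [g], and dropping it keeps [g]. This gives the
    containment of HS_(k+1) in HS_k. *)
Lemma borel_shift_pred k w : borel_shift d G k.+1 w ->
  exists2 x, borel_shift d G k x & (x <= w)%MM.
Proof.
move=> [sw dw [g [Gg gw gtop]]].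
have [c gc] : exists c, (g c < w c)%N by apply: mdeg_lt_ex; rewrite dw (degG Gg); lia.
exists (w - U_(c))%MM; last exact: lem_subr.
by apply: borel_shift_remove gtop _ _ => //; have := sw c; lia.
Qed.

(** The vector e_j - e_i becomes the difference x - y: a variable other than x_j outside [g] is
    removed, and then [j] is exchanged for [i]. *)
Lemma borel_shift_edge k w (i j : 'I_n) : borel_shift d G k.+1 w -> (i < j)%N ->
    w j != 0%N -> w i = 0%N ->
  exists x y, [/\ borel_shift d G k x, borel_shift d G k y & (x + U_(i) = y + U_(j))%MM].
Proof.
move=> [sw dw [g [Gg gw gtop]]] ij wj wi.
have nij : i != j by rewrite neq_ltn ij.
have removeP c : (g c < w c)%N -> borel_shift d G k (w - U_(c))%MM.
  by move=> gc; apply: borel_shift_remove gtop _ _ => //; have := sw c; lia.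
have [/existsP[c /andP[cj gc]]|/existsPn nc] := boolP [exists c, (c != j) && (g c < w c)%N].
  have xj : (w - U_(c))%MM j != 0%N by rewrite mnmBE mnm1E (negbTE cj) subn0.
  have xi : (w - U_(c))%MM i = 0%N by rewrite mnmBE wi sub0n.
  exists (w - U_(c))%MM, (w - U_(c) - U_(j) + U_(i))%MM.
  split; [exact: removeP|exact: borel_shift_exchange (removeP _ gc) _ _ _|].
  apply/mnmP=> p; rewrite !mnmE; case: (eqVneq j p) xj => [<-|]; rewrite ?mnmE; lia.
have [c gc] : exists c, (g c < w c)%N by apply: mdeg_lt_ex; rewrite dw (degG Gg); lia.
have ej : c = j by have := nc c; rewrite gc andbT negbK => /eqP.
have {}gc : (g j < w j)%N by rewrite -ej.
have [q jq gq] := gtop j wj.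
have neqj : q != j by apply: contraNneq gq => ->; have := sw j; lia.
have ltjq : (j < q)%N by rewrite ltn_neqAle eq_sym neqj.
have wq : w q != 0%N by move/mnm_lepP/(_ q): gw; lia.
have xq : (w - U_(j))%MM q != 0%N by rewrite mnmBE mnm1E (eq_sym j q) (negbTE neqj) subn0.
have xi : (w - U_(j))%MM i = 0%N by rewrite mnmBE wi sub0n.
have xj : (w - U_(j))%MM j = 0%N by rewrite mnmBE mnm1E eqxx; have := sw j; lia.
(* Only x_j is outside [g]; after its removal, a larger variable x_q of [g] is exchanged once for
   [j] and once for [i]. *)
exists (w - U_(j) - U_(q) + U_(j))%MM, (w - U_(j) - U_(q) + U_(i))%MM; split.
- exact: borel_shift_exchange (removeP _ gc) _ _ _.
- by apply: borel_shift_exchange (removeP _ gc) _ _ _ => //; exact: ltn_trans ltjq.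
- by apply/mnmP=> p; rewrite !mnmE; lia.
Qed.

End BorelExchange.

(** * Comparison of ranks *)

(** The leading 1 turns affine relations between exponents into linear ones, and later records the
    degree of a product of generators. *)
Definition homog_row n (w : 'X_{1..n}) : 'rV[rat]_(1 + n) :=
  row_mx 1%:M (\row_l (w l)%:R).

Definition homog_mx n g (a : 'I_g -> 'X_{1..n}) : 'M[rat]_(g, 1 + n) :=
  \matrix_(j < g) homog_row (a j).

Lemma homog_row_sub n g (a : 'I_g -> 'X_{1..n}) j : (homog_row (a j) <= homog_mx a)%MS.
Proof. by rewrite -(rowK (fun j => homog_row (a j))); exact: row_sub. Qed.

Lemma homog_rowB n (x y v w : 'X_{1..n}) : (x + w = y + v)%MM ->
  homog_row x - homog_row y = homog_row v - homog_row w.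
Proof.
move=> e; rewrite /homog_row !opp_row_mx !add_row_mx; congr row_mx.
apply/rowP=> l; rewrite !mxE; apply/eqP; rewrite subr_eq addrAC eq_sym subr_eq -!natrD.
by move/mnmP/(_ l): e; rewrite !mnmE eqr_nat addnC [in X in _ -> X]addnC => ->.
Qed.

Section BorelRank.
Variables (n d k g g' : nat) (G : set 'X_{1..n}).
Hypothesis degG : forall g, G g -> mdeg g = d.
Hypothesis borelG : forall g (i j : 'I_n), G g -> (i < j)%N -> g j != 0%N -> g i = 0%N ->
  G (g - U_(j) + U_(i))%MM.
Variables (a : 'I_g -> 'X_{1..n}) (a' : 'I_g' -> 'X_{1..n}).
Hypothesis aP : forall w, (exists j, a j = w) <-> borel_shift d G k w.
Hypothesis a'P : forall w, (exists j, a' j = w) <-> borel_shift d G k.+1 w.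

Let row_a w : borel_shift d G k w -> (homog_row w <= homog_mx a)%MS.
Proof. by case/aP=> j <-; exact: homog_row_sub. Qed.

Let exchange_sub w (i j : 'I_n) : borel_shift d G k.+1 w -> (i < j)%N ->
    w j != 0%N -> w i = 0%N ->
  (homog_row w - homog_row (w - U_(j) + U_(i))%MM <= homog_mx a)%MS.
Proof.
move=> Gw ij wj wi; have [x [y [Gx Gy e]]] := borel_shift_edge degG borelG Gw ij wj wi.
rewrite (@homog_rowB _ _ _ x y); last first.
  rewrite addmC [RHS]addmC addmA; apply/mnmP=> p; move/mnmP/(_ p): e; rewrite !mnmE.
  by case: (eqVneq j p) => [<-|]; lia.
by rewrite addmx_sub ?row_a // eqmx_opp row_a.
Qed.

(** Induction on the distance: exchanging a variable of one monomial for a variable of the other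
    brings the two closer, and changes the row by a vector already known to lie in the span. *)
Lemma borel_shift_row_diff w w' : borel_shift d G k.+1 w -> borel_shift d G k.+1 w' ->
  (homog_row w - homog_row w' <= homog_mx a)%MS.
Proof.
have [N] := ubnP (mdeg (w - w')); elim: N w w' => // N IH w w' ltN Gw Gw'.
have [[sw dw _] [sw' dw' _]] := (Gw, Gw').
have [ww'|/negP nww'] := boolP (w <= w')%MM.
  rewrite (@mdeg_le_eq _ w' w) ?subrr ?sub0mx ?dw ?dw' //.
have [j jP] : exists j, (w' j < w j)%N.
  by apply/existsP; apply: contra_notT nww' => /existsPn H; apply/mnm_lepP => p; have := H p; lia.
have [i iP] : exists i, (w i < w' i)%N.
  apply/existsP; apply: contraTT jP => /existsPn H.
  rewrite (@mdeg_le_eq _ w w') ?ltnn ?dw ?dw' //.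
  by apply/mnm_lepP => p; have := H p; lia.
have wj : w j != 0%N by lia.
have w'i : w' i != 0%N by lia.
have wi : w i = 0%N by have := sw' i; lia.
have w'j : w' j = 0%N by have := sw j; lia.
have ltm (x y : 'X_{1..n}) : (x + U_(j) = w - w')%MM -> (y <= x)%MM -> (mdeg y < N)%N.
  move=> e /submK e'; have := congr1 mdeg e; have := congr1 mdeg e'.
  by rewrite !mdegD mdeg1; lia.
have ej : (w - w' - U_(j) + U_(j) = w - w')%MM.
  by apply: submK; apply/mnm_lepP=> p; rewrite mnm1E mnmBE; case: eqVneq => [<-|]; lia.
have [ij|ji|e] := ltngtP i j; last by move: iP; rewrite (val_inj e); lia.
  set w1 := (w - U_(j) + U_(i))%MM.
  have -> : homog_row w - homog_row w' =
      (homog_row w - homog_row w1) + (homog_row w1 - homog_row w').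
    by rewrite addrA subrK.
  apply: addmx_sub; first exact: exchange_sub.
  apply: IH => //; last exact: (borel_shift_exchange borelG).
  apply: ltm ej _; apply/mnm_lepP=> p; rewrite !mnmE.
  by case: (eqVneq i p) => [<-|]; lia.
(* Borel moves only lower indices, so for j < i the exchange is made in [w']. *)
set w1 := (w' - U_(i) + U_(j))%MM.
have -> : homog_row w - homog_row w' =
    (homog_row w - homog_row w1) - (homog_row w' - homog_row w1).
  by rewrite opprB addrA subrK.
apply: addmx_sub; last by rewrite eqmx_opp; exact: exchange_sub.
apply: IH => //; last exact: (borel_shift_exchange borelG).
apply: ltm ej _; apply/mnm_lepP=> p; rewrite !mnmE; have := sw p; have := sw' p.
by case: (eqVneq i p) => [<-|_]; [lia | case: (eqVneq j p) => [<-|]; lia].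
Qed.

Lemma borel_shift_rank : (\rank (homog_mx a') <= \rank (homog_mx a))%N.
Proof.
case: (posnP g') => [g0|g'0].
  by apply: leq_trans (rank_leq_row _) _; rewrite g0.
pose w0 := a' (Ordinal g'0).
have Gw0 : borel_shift d G k.+1 w0 by apply/a'P; exists (Ordinal g'0).
have [y0 Gy0 _] := borel_shift_pred degG Gw0.
(* The unipotent map L fixes differences of rows and sends the row of w0 to that of y0. *)
pose D := homog_row y0 - homog_row w0.
pose E : 'cV[rat]_(1 + n) := col_mx 1%:M 0.
have rowE w : homog_row w *m E = 1 by rewrite mul_row_col mulmx1 mulmx0 addr0.
have DE : D *m E = 0 by rewrite mulmxBl !rowE subrr.
pose L : 'M_(1 + n) := 1%:M + E *m D; pose L' : 'M_(1 + n) := 1%:M - E *m D.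
have LL' : L *m L' = 1%:M.
  have EDED : E *m D *m (E *m D) = 0 by rewrite mulmxA -(mulmxA E D E) DE mulmx0 mul0mx.
  by rewrite mulmxDl mul1mx mulmxBr mulmx1 EDED subr0 subrK.
have sub : (homog_mx a' *m L <= homog_mx a)%MS.
  apply/row_subP => j; rewrite row_mul rowK mulmxDr mulmx1 mulmxA rowE mul1mx.
  have -> : homog_row (a' j) + D = homog_row (a' j) - homog_row w0 + homog_row y0.
    by rewrite /D addrA addrAC.
  by rewrite addmx_sub ?row_a // borel_shift_row_diff //; apply/a'P; exists j.
rewrite -[homog_mx a']mulmx1 -LL' mulmxA.
exact: leq_trans (mxrankM_maxl _ _) (mxrankS sub).
Qed.

End BorelRank.

(** * Algebraic independence along chains of primes *)

(** Exponent vectors with [s] entries below [N], built so that the first exponent splits off. *)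
Fixpoint box (N s : nat) : finType :=
  if s is s'.+1 then ('I_N * box N s')%type : finType else unit : finType.

Fixpoint box_mon (A : comNzRingType) (N s : nat) (p : nat -> A) : box N s -> A :=
  match s with
  | 0 => fun=> 1
  | s'.+1 => fun b => p 0%N ^+ b.1 * box_mon (fun i => p i.+1) b.2
  end.

Lemma card_box N s : #|box N s| = (N ^ s)%N.
Proof. by elim: s => [|s IH]; rewrite ?card_unit // card_prod card_ord IH expnS. Qed.

Lemma rmorph_box_mon (A B : comNzRingType) (f : {rmorphism A -> B}) N s (p : nat -> A)
  (b : box N s) : f (box_mon p b) = box_mon (f \o p) b.
Proof. by elim: s p b => [|s IH] p b /=; rewrite ?rmorph1 // rmorphM rmorphXn IH. Qed.

Section Independence.
Variables (K : fieldType) (A : comNzRingType) (iota : {rmorphism K -> A}).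

Lemma sum_exp_factor N (x : A) (e : 'I_N -> A) (k : 'I_N) :
    (forall k' : 'I_N, (k' < k)%N -> e k' = 0) ->
  exists y, \sum_(k' < N) x ^+ k' * e k' = x ^+ k * (e k + x * y).
Proof.
move=> e0; exists (\sum_(k' < N | k' != k) x ^+ (k' - k.+1) * e k').
rewrite (bigD1 k) //= mulrDr; congr (_ + _).
rewrite mulrA -exprSr mulr_sumr; apply: eq_bigr => k' k'k.
have [lt|gt|/val_inj kk] := ltngtP k' k; last by rewrite kk eqxx in k'k.
  by rewrite e0 // !mulr0.
by rewrite mulrA -exprD subnKC.
Qed.

(** Sort the relation by powers of p_0. The lowest coefficient gives p_0^k (e_k + p_0 y) in C_0; as
    p_0 lies in C_1 but not in the prime C_0, e_k lies in C_1, and the shorter chain applies. *)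
Lemma chain_independent N s (C : nat -> set A) (p : nat -> A) :
    prime_chain C s -> (forall i, (i < s)%N -> C i.+1 (p i) /\ ~ C i (p i)) ->
  forall c : box N s -> K, C 0%N (\sum_b iota (c b) * box_mon p b) -> forall b, c b = 0.
Proof.
elim: s C p => [|s IH] C p [primeC ltC] pC c.
  have [[_ _ CM] C1 _] := primeC 0%N isT.
  rewrite (bigD1 tt) //= big1; last by case.
  rewrite addr0 mulr1 => Cc [].
  apply: contra_notP C1 => c0; have := CM (iota (c tt)^-1) _ Cc.
  by rewrite -rmorphM mulVf ?rmorph1 //; apply/eqP.
pose e (k : 'I_N) := \sum_b iota (c (k, b)) * box_mon (fun i => p i.+1) b.
have -> : \sum_b iota (c b) * box_mon p b = \sum_(k < N) p 0%N ^+ k * e k.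
  rewrite (eq_bigr (fun kb : 'I_N * box N s =>
             p 0%N ^+ kb.1 * (iota (c (kb.1, kb.2)) * box_mon (fun i => p i.+1) kb.2))).
    rewrite -(pair_bigA _ (fun (k : 'I_N) (b : box N s) =>
                p 0%N ^+ k * (iota (c (k, b)) * box_mon (fun i => p i.+1) b))) /=.
    by apply: eq_bigr => k _; rewrite mulr_sumr.
  by case=> k b _ /=; rewrite mulrCA.
move=> C0.
have c0 k : forall b, c (k, b) = 0.
  have [M] := ubnP (k : nat); elim: M k => // M IHM k kM.
  have e0 (k' : 'I_N) : (k' < k)%N -> e k' = 0.
    by move=> lt; rewrite /e big1 // => b _; rewrite IHM ?rmorph0 ?mul0r //; lia.
  have [y ey] := sum_exp_factor (p 0%N) e0; rewrite ey in C0.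
  have [C1p nC0p] := pC 0%N isT.
  have [[C00 C0D C0M] nC01 C0P] := primeC 0%N isT.
  have nX j : ~ C 0%N (p 0%N ^+ j).
    by elim: j => [|j IHj]; rewrite ?expr0 // exprS => /C0P[].
  have {C0P} C0e : C 0%N (e k + p 0%N * y) by case/C0P: C0 => // /nX.
  have C1I := (primeC 1%N isT); have [[_ C1D C1M] _ _] := C1I.
  have C1e : C 1%N (e k).
    have -> : e k = (e k + p 0%N * y) - p 0%N * y by rewrite addrK.
    apply: is_idealB; first by case: C1I.
      by have [/(_ _ C0e)] := ltC 0%N isT.
    by rewrite mulrC; exact: C1M.
  apply: (IH (fun i => C i.+1) (fun i => p i.+1) _ _ (fun b => c (k, b)) C1e) => [|i lti].
    by split=> i lti; [apply: primeC | apply: ltC].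
  exact: pC.
by case.
Qed.

End Independence.

(** A count: the box products outnumber the monomials that can occur in them. *)
Lemma mpoly_dependent (K : fieldType) (r s : nat) (q : nat -> {mpoly K[r]}) : (r < s)%N ->
  exists N (c : box N s -> K), (exists b, c b != 0) /\ \sum_b c b *: box_mon q b = 0.
Proof.
(* Exponents in the products are below [Q], so at most Q^r monomials occur. Since Q <= N E, one has
   Q^r <= N^r E^r < N^(r+1) <= N^s. *)
move=> rs; pose D := (\max_(i < s) msize (q i))%N.
have qD i m : (i < s)%N -> m \in msupp (q i) -> (mdeg m <= D)%N.
  move=> lti mq; apply: leq_trans (ltnW (msize_mdeg_lt mq)) _.
  exact: (leq_bigmax (Ordinal lti)).
pose E := (s * D).+1; pose N := (E ^ r).+1; pose Q := (N * s * D).+1.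
have deg_mon t (p : nat -> {mpoly K[r]}) (b : box N t) m :
    (forall i m, (i < t)%N -> m \in msupp (p i) -> (mdeg m <= D)%N) ->
    m \in msupp (box_mon p b) -> (mdeg m <= N * t * D)%N.
  elim: t p b m => [|t IH] p b m pD /=.
    by rewrite msupp1 inE => /eqP->; rewrite mdeg0.
  move/msuppM_le/allpairsP => -[[m1 m2] /= [m1p m2p ->]]; rewrite mdegD.
  have : (mdeg m2 <= N * t * D)%N by apply: IH m2p => i m' lti; apply: pD.
  have : (mdeg m1 <= b.1 * D)%N.
    elim: (nat_of_ord b.1) m1 m1p => [|j IHj] m1.
      by rewrite expr0 msupp1 inE => /eqP->; rewrite mdeg0.
    rewrite exprS => /msuppM_le/allpairsP[[m3 m4] /= [m3p m4p ->]]; rewrite mdegD.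
    by have := IHj _ m4p; have := pD 0%N _ isT m3p; lia.
  by have := ltn_ord b.1; nia.
pose T := {ffun 'I_r -> 'I_Q}; pose mn (f : T) : 'X_{1..r} := [multinom (f i : nat) | i < r].
pose M : 'M[K]_(#|box N s|, #|T|) :=
  \matrix_(i, j) (box_mon q (enum_val i))@_(mn (enum_val j)).
have /negP nfree : ~~ row_free M.
  rewrite /row_free neq_ltn; apply/orP; left; apply: leq_ltn_trans (rank_leq_col _) _.
  rewrite card_box card_ffun !card_ord.
  have QE : (Q <= N * E)%N by rewrite /Q /E; have : (0 < N)%N by []; nia.
  have QEr : (Q ^ r <= (N * E) ^ r)%N by case: (posnP r) => [->|r0]; rewrite ?expn0 ?leq_exp2r.
  apply: leq_ltn_trans QEr _.
  apply: leq_trans (leq_pexp2l _ rs); rewrite // expnS expnMn mulnC.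
  by rewrite ltn_pmul2r ?expn_gt0.
have [i nz] : exists i, row i (kermx M) != 0.
  apply/existsP; apply: contra_notT nfree => /existsPn H; rewrite -kermx_eq0.
  by apply/eqP/row_matrixP => i; rewrite row0; apply/eqP; rewrite -[_ == _]negbK H.
pose v := row i (kermx M).
have vM : v *m M = 0 by rewrite /v -row_mul mulmx_ker row0.
exists N, (fun b => v 0 (enum_rank b)); split.
  have [j nzj] : exists j, v 0 j != 0.
    apply/existsP; apply: contraNT nz => /existsPn H; apply/eqP/rowP=> j.
    by rewrite [RHS]mxE; apply/eqP; rewrite -[_ == _]negbK H.
  by exists (enum_val j); rewrite enum_valK.
apply/mpolyP=> m; rewrite mcoeff0 raddf_sum /=.
have [/forallP mQ|] := boolP [forall i, m i < Q]%N; last first.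
  rewrite negb_forall => /existsP[l]; rewrite -leqNgt => ml.
  rewrite big1 // => b _; rewrite mcoeffZ; apply/eqP; rewrite mulf_eq0; apply/orP; right.
  rewrite mcoeff_eq0; apply: contraL ml => /(deg_mon _ _ _ _ qD) le; rewrite -ltnNge ltnS.
  by apply: leq_trans le; rewrite mdegE (bigD1 l) //= leq_addr.
pose f : T := [ffun l => Ordinal (mQ l)].
have mf : mn f = m by apply/mnmP=> l; rewrite mnmE ffunE.
move/rowP/(_ (enum_rank f)): vM; rewrite !mxE => vM; rewrite -[RHS]vM.
rewrite [RHS](reindex (@enum_rank (box N s))) /=; last first.
  by exists enum_val => ? _; rewrite ?enum_valK ?enum_rankK.
by apply: eq_bigr => b _; rewrite !mxE mcoeffZ !enum_rankK mf.
Qed.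

(** Choose p_i in P_(i+1) but not in P_i. If s > r, their images under [sigma] are dependent, and
    the relation pulls back into P_0, against independence along the chain. *)
Lemma prime_chain_bound (K : fieldType) (g r s : nat)
    (sigma : {rmorphism {mpoly K[g]} -> {mpoly K[r]}}) (P : nat -> set {mpoly K[g]}) :
    (forall c, sigma c%:MP = c%:MP) -> prime_chain P s ->
  (forall f, sigma f = 0 -> P 0%N f) -> (s <= r)%N.
Proof.
move=> sigmaC chP kerP; rewrite leqNgt; apply/negP => rs.
have pE i : exists x, (i < s)%N -> P i.+1 x /\ ~ P i x.
  have [lti|] := boolP (i < s)%N; last by exists 0.
  have [_ /(_ i lti) [_ nsub]] := chP.
  by move: nsub => /existsNP[x /not_implyP[]]; exists x.
have [p pP] := choice pE.
have [N [c [[b cb] sum0]]] := mpoly_dependent (sigma \o p) rs.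
case/eqP: cb; apply: (@chain_independent _ _ (@mpolyC g K) N s P p chP pP c).
apply: kerP; rewrite rmorph_sum /= -[RHS]sum0; apply: eq_bigr => b' _.
by rewrite rmorphM /= sigmaC rmorph_box_mon mul_mpolyC.
Qed.

(** * Monomial maps *)

Section FiberSums.
Variables (K : fieldType) (g : nat).
Implicit Types (F : {mpoly K[g]}) (m : 'X_{1..g}).

(** For the exponent map [y] of a monomial map this describes the kernel; leaving [y] general lets
    kernels be compared through fibers. *)
Definition fiber_sums_vanish (T : eqType) (y : 'X_{1..g} -> T) F :=
  forall t, \sum_(m <- msupp F | y m == t) F@_m = 0.

(** Each fiber of [y'] is a union of fibers of [y]. *)
Lemma fiber_sums_vanish_coarsen (T T' : eqType) (y : 'X_{1..g} -> T) (y' : 'X_{1..g} -> T') F :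
  (forall m m', y m = y m' -> y' m = y' m') ->
  fiber_sums_vanish y F -> fiber_sums_vanish y' F.
Proof.
move=> yy' H t'; pose U := undup [seq y m | m <- msupp F].
have split_sum m : m \in msupp F -> F@_m = \sum_(t <- U | y m == t) F@_m.
  move=> mF; rewrite big_mkcond (bigD1_seq (y m)) ?undup_uniq //=; last first.
    by rewrite mem_undup map_f.
  rewrite eqxx big1_seq ?addr0 // => t /andP[ne _].
  by rewrite eq_sym (negbTE ne).
rewrite big_seq_cond (eq_bigr (fun m => \sum_(t <- U | y m == t) F@_m)); last first.
  by move=> m /andP[/split_sum].
rewrite -big_seq_cond (exchange_big_dep xpredT) //= big1 // => t _.
have [/hasP[m0 m0F /andP[/eqP ym0 /eqP y'm0]]|nh] :=
    boolP (has (fun m => (y m == t) && (y' m == t')) (msupp F)).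
  rewrite -[RHS](H t); apply: eq_bigl => m; apply: andb_idl => /eqP ym; apply/eqP.
  by rewrite -y'm0; apply: yy'; rewrite ym.
rewrite big_seq_cond big1 // => m /andP[mF /andP[y'm ym]].
by case/hasP: nh; exists m => //; rewrite ym.
Qed.

Section MonomialMap.
Variables (r : nat) (E : 'I_g -> 'X_{1..r}).

Definition mono_exp m : 'X_{1..r} := (\sum_j E j *+ m j)%MM.

Definition mono_map : {mpoly K[g]} -> {mpoly K[r]} := mmap (@mpolyC r K) (fun j => 'X_[E j]).

HB.instance Definition _ := GRing.RMorphism.on mono_map.

Lemma mono_expE m c : mono_exp m c = (\sum_j E j c * m j)%N.
Proof. by rewrite mnm_sumE; apply: eq_bigr => j _; rewrite mulmnE. Qed.

Lemma mono_exp_mmap1 m : mmap1 (fun j => 'X_[K, E j]) m = 'X_[mono_exp m].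
Proof.
rewrite /mono_exp (big_morph (fun x => 'X_[K, x]) (@mpolyXD r K) (@mpolyX0 r K)).
by apply: eq_bigr => j _; rewrite mpolyXn.
Qed.

Lemma mono_mapE F : mono_map F = \sum_(m <- msupp F) F@_m *: 'X_[mono_exp m].
Proof. by apply: eq_bigr => m _; rewrite mono_exp_mmap1 mul_mpolyC. Qed.

Lemma mono_mapC c : mono_map c%:MP = c%:MP.
Proof. exact: mmapC. Qed.

Lemma mono_mapX m : mono_map 'X_[m] = 'X_[mono_exp m].
Proof. by rewrite -mono_exp_mmap1; exact: mmapX. Qed.

Lemma mono_map_eq0 F : mono_map F = 0 <-> fiber_sums_vanish mono_exp F.
Proof.
have coefE t : (mono_map F)@_t = \sum_(m <- msupp F | mono_exp m == t) F@_m.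
  rewrite mono_mapE raddf_sum /= [RHS]big_mkcond; apply: eq_bigr => m _ /=.
  by rewrite mcoeffZ mcoeffX; case: eqP => _; rewrite ?mulr1 ?mulr0.
split=> [F0 t|H]; first by rewrite -coefE F0 mcoeff0.
by apply/mpolyP => t; rewrite coefE H mcoeff0.
Qed.

End MonomialMap.
End FiberSums.

(** * Maximal independent columns and clearing of denominators *)

Section MaxIndependentColumns.
Variables (F : fieldType) (p q : nat) (M : 'M[F]_(p, q)).

Definition max_columns : 'I_(\rank M^T) -> 'I_q := maxrankfun M^T.

Lemma max_columns_determine (v : 'rV[F]_p) :
  (forall c, (v *m M) 0 (max_columns c) = 0) -> v *m M = 0.
Proof.
move=> H; have /submxP[N eN] : (M^T <= rowsub max_columns M^T)%MS.
  by rewrite eq_maxrowsub.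
have -> : M = colsub max_columns M *m N^T.
  apply: trmx_inj; rewrite trmx_mul trmxK {1}eN; congr (_ *m _).
  by apply/matrixP=> i j; rewrite !mxE.
rewrite mulmxA; suff -> : v *m colsub max_columns M = 0 by rewrite mul0mx.
by apply/rowP=> c; rewrite [RHS]mxE -[RHS](H c) !mxE; apply: eq_bigr => i _; rewrite !mxE.
Qed.

Lemma max_columns_dual (c : 'I_(\rank M^T)) :
  exists v : 'rV[F]_p, forall c', (v *m M) 0 (max_columns c') = (c' == c)%:R.
Proof.
have free : row_free (rowsub max_columns M^T) by exact: maxrowsub_free.
have /row_freeP[N eN] := free.
exists (col c N)^T => c'; move/matrixP/(_ c' c): eN; rewrite mxE [RHS]mxE => <-.
by rewrite mxE; apply: eq_bigr => i _; rewrite !mxE mulrC.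
Qed.

End MaxIndependentColumns.

(** Positive and negative parts of a multiple of [v] will serve as the two exponents of a
    binomial. *)
Lemma clear_denominators p (v : 'rV[rat]_p) : exists N (ep em : 'I_p -> nat),
  (0 < N)%N /\ forall j, v 0 j * N%:R = (ep j)%:R - (em j)%:R.
Proof.
pose N := (\prod_j `|denq (v 0%R j)|)%N.
have /choice[z zP] : forall j, exists z : int, v 0 j * N%:R = z%:~R.
  move=> j; exists (numq (v 0 j) * (\prod_(i | i != j) `|denq (v 0%R i)|)%N%:Z).
  rewrite /N (bigD1 j) //= natrM mulrA intrM numqE; congr (_ * _ * _).
  by rewrite -[in RHS]absz_denq.
exists N, (fun j => if z j is Posz k then k else 0%N), (fun j => if z j is Negz k then k.+1 else 0%N).
split; first by apply: prodn_gt0 => j; rewrite absz_gt0 denq_neq0.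
by move=> j; rewrite zP; case: (z j) => k; rewrite ?subr0 // NegzE sub0r rmorphN.
Qed.

(** * The fiber ring of a monomial ideal *)

Lemma sub_mcoeff0_irrelevant (K : fieldType) n (f : {mpoly K[n]}) :
  irrelevant_ideal (f - (f@_0%MM)%:MP).
Proof.
have [_ _ IM] := ideal_genP (range (fun i : 'I_n => 'X_i : {mpoly K[n]})).
rewrite [X in _ X]mpolyE big_seq; apply: is_ideal_sum => [|m]; first exact: ideal_genP.
rewrite mcoeff_msupp => fm; have m0 : m != 0%MM.
  by apply: contraNneq fm => ->; rewrite mcoeffB mcoeffC eqxx mulr1 subrr.
have /existsP[i mi] : [exists i, m i != 0%N].
  by apply: contraNT m0 => /existsPn H; apply/eqP/mnmP=> i; have := H i; rewrite mnm0E; lia.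
have /submK <- : (U_(i) <= m)%MM by apply/mnm_lepP=> j; rewrite mnm1E; case: eqVneq => [<-|]; lia.
rewrite mpolyXD scalerAl; apply: IM => J [_ GJ]; apply: GJ; by exists i.
Qed.

(** * Lower bounds on the order of polynomials in an ideal *)

Section OrderIdeals.
Variables (K : fieldType) (n : nat).
Local Notation S := {mpoly K[n]}.

Definition order_ge e : set S := [set f | forall m, m \in msupp f -> (e <= mdeg m)%N].

Lemma order_geM d e f h : order_ge d f -> order_ge e h -> order_ge (d + e) (f * h).
Proof.
move=> df eh m /msuppM_le/allpairsP[[m1 m2] /= [/df le1 /eh le2 ->]].
by rewrite mdegD leq_add.
Qed.

Lemma order_ge_ideal e : is_ideal (order_ge e).
Proof.
split=> [m|x y Hx Hy m /msuppD_le|a x Hx]; first by rewrite msupp0.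
  by rewrite mem_cat => /orP[/Hx|/Hy].
by rewrite -[e]add0n; apply: order_geM.
Qed.

Lemma order_ge_gen e G : (G `<=` order_ge e)%classic -> (ideal_gen G `<=` order_ge e)%classic.
Proof. by move=> Ge f; apply; split=> //; exact: order_ge_ideal. Qed.

Lemma order_ge_mul d e I J : (I `<=` order_ge d)%classic -> (J `<=` order_ge e)%classic ->
  (ideal_mul I J `<=` order_ge (d + e))%classic.
Proof.
by move=> Id Je; apply: order_ge_gen => _ [x [y [/Id dx /Je ey ->]]]; exact: order_geM.
Qed.

Lemma order_ge_pow d J r : (J `<=` order_ge d)%classic ->
  (ideal_pow J r `<=` order_ge (r * d))%classic.
Proof. by move=> Jd; elim: r => [|r IH] //; rewrite mulSn; exact: order_ge_mul. Qed.

Lemma order_ge_irrelevant : (@irrelevant_ideal K n `<=` order_ge 1)%classic.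
Proof.
apply: order_ge_gen => _ [i _ <-] m; rewrite msuppX inE => /eqP->.
by rewrite mdeg1.
Qed.

End OrderIdeals.

Lemma polyC_mul_sub (A : comNzRingType) (c c0 x : A) (p : {poly A}) :
  (c * x)%:P * p - c0%:P * (x%:P * p) = ((c - c0) * x)%:P * p.
Proof. by rewrite mulrA -mulrBl -polyCM -polyCB -mulrBl. Qed.

Section FiberPresentation.
Variables (K : fieldType) (n g : nat) (a : 'I_g -> 'X_{1..n}).
Local Notation S := {mpoly K[n]}.
Local Notation T := {mpoly K[g]}.

Definition monomial_ideal : set S := ideal_gen (range (fun j => 'X_[a j])).
Local Notation J := monomial_ideal.
Local Notation Q := {ideal_quot (@fiber_pred K n J)}.

Definition rees_map : T -> {poly S} :=
  mmap (polyC \o @mpolyC n K) (fun j => 'X_[a j]%:P * 'X).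

HB.instance Definition _ := GRing.RMorphism.on rees_map.

Lemma rees_mapE F :
  rees_map F = \sum_(m <- msupp F) (F@_m *: 'X_[mono_exp a m])%:P * 'X^(mdeg m).
Proof.
apply: eq_bigr => m _; rewrite /mmap1 -mul_mpolyC polyCM -mulrA; congr (_ * _).
have mE : \prod_(i < g) ('X_[K, a i]%:P ^+ m i : {poly S}) = ('X_[mono_exp a m])%:P.
  rewrite -mono_exp_mmap1 rmorph_prod; apply: eq_bigr => i _; by rewrite rmorphXn.
rewrite -mE mdegE -prodrXr -big_split /=.
by apply: eq_bigr => i _; rewrite exprMn.
Qed.

Lemma rees_mapC c : rees_map c%:MP = c%:MP%:P.
Proof. exact: mmapC. Qed.

Lemma rees_mapX j : rees_map 'X_j = 'X_[a j]%:P * 'X.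
Proof. by rewrite /rees_map mmapX mmap1U. Qed.

Lemma coef_rees_map F r x : ((rees_map F)`_r)@_x =
  \sum_(m <- msupp F | (mdeg m, mono_exp a m) == (r, x)) F@_m.
Proof.
rewrite rees_mapE coef_sum raddf_sum /= [RHS]big_mkcond; apply: eq_bigr => m _ /=.
rewrite coefCM coefXn xpair_eqE eq_sym; case: eqP => _ /=; last by rewrite mulr0 mcoeff0.
by rewrite mulr1 mcoeffZ mcoeffX; case: eqP; rewrite ?mulr1 ?mulr0.
Qed.

Lemma rees_map_eq0 F : rees_map F = 0 <-> fiber_sums_vanish (fun m => (mdeg m, mono_exp a m)) F.
Proof.
split=> [F0 [r x]|H]; first by rewrite -coef_rees_map F0 coef0 mcoeff0.
by apply/polyP => r; apply/mpolyP => x; rewrite coef_rees_map H coef0 mcoeff0.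
Qed.

Lemma mem_monomial_ideal j : J 'X_[a j].
Proof. by move=> I [_ GI]; apply: GI; exists j. Qed.

Lemma rees_poly_gen f : J f -> f%:P * 'X \in rees_pred J.
Proof.
move=> Jf; apply/rees_predP => -[|[|r]]; rewrite coefCM coefX ?mulr0 ?mulr1 //=.
  by rewrite -[f]mulr1; exact: ideal_mul_mem.
by case: (ideal_powP J r.+2).
Qed.

Lemma rees_poly_const (c : S) : c%:P \in rees_pred J.
Proof.
apply/rees_predP => -[|r]; rewrite coefC //=.
by case: (ideal_powP J r.+1).
Qed.

Lemma rees_map_mem F : rees_map F \in rees_pred J.
Proof.
apply: rpred_sum => m _; apply: rpredM; first exact: rees_poly_const.
apply: rpred_prod => j _; apply: rpredX; apply: rees_poly_gen.
exact: mem_monomial_ideal.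
Qed.

Definition rees_elt (F : T) : rees J := Rees (rees_map_mem F).

Lemma rees_eltD F H : rees_elt (F + H) = rees_elt F + rees_elt H.
Proof. by apply: val_inj; rewrite rmorphD /= rmorphD. Qed.

Lemma rees_eltB F H : rees_elt (F - H) = rees_elt F - rees_elt H.
Proof. by apply: val_inj; rewrite rmorphB /= rmorphB. Qed.

Lemma rees_eltM F H : rees_elt (F * H) = rees_elt F * rees_elt H.
Proof. by apply: val_inj; rewrite rmorphM /= rmorphM. Qed.

Lemma rees_elt1 : rees_elt 1 = 1.
Proof. by apply: val_inj; rewrite /= rmorph1. Qed.

Lemma rees_elt0 : rees_elt 0 = 0.
Proof. by apply: val_inj; rewrite /= rmorph0. Qed.

Definition presented (p : rees J) := exists F, p - rees_elt F \in @fiber_pred K n J.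

Lemma rees_valB (p q : rees J) : rees_val (p - q) = rees_val p - rees_val q.
Proof. exact (rmorphB (\val : rees J -> {poly S}) p q). Qed.

Lemma rees_valM (p q : rees J) : rees_val (p * q) = rees_val p * rees_val q.
Proof. exact (rmorphM (\val : rees J -> {poly S}) p q). Qed.

Lemma fiber_predD (p q : rees J) :
  p \in @fiber_pred K n J -> q \in @fiber_pred K n J -> p + q \in @fiber_pred K n J.
Proof.
by have [_ _ H] := fiber_idealr_closed J => pF qF; rewrite -[p]mul1r; apply: H.
Qed.

Lemma fiber_predM (p q : rees J) : q \in @fiber_pred K n J -> p * q \in @fiber_pred K n J.
Proof.
have [H0 _ H] := fiber_idealr_closed J => qF; rewrite -[p * q]addr0; exact: H.
Qed.

Lemma presentedD p q : presented p -> presented q -> presented (p + q).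
Proof.
move=> [F Fp] [H Hq]; exists (F + H); by rewrite rees_eltD opprD addrACA; exact (fiber_predD Fp Hq).
Qed.

Lemma presentedM p q : presented p -> presented q -> presented (p * q).
Proof.
move=> [F Fp] [H Hq]; exists (F * H); rewrite rees_eltM.
have -> : p * q - rees_elt F * rees_elt H =
    p * (q - rees_elt H) + rees_elt H * (p - rees_elt F).
  by rewrite mulrBr mulrBr (mulrC _ p) (mulrC (rees_elt H) (rees_elt F)) addrA subrK.
exact (fiber_predD (fiber_predM p Hq) (fiber_predM (rees_elt H) Fp)).
Qed.

Lemma presented_fiber p q : p - q \in @fiber_pred K n J -> presented q -> presented p.
Proof.
move=> pq [F qF]; exists F; rewrite -(subrK q p) -addrA.
exact (fiber_predD pq qF).
Qed.

Lemma presented_rees F : presented (rees_elt F).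
Proof. by exists F; rewrite subrr; case: (fiber_idealr_closed J). Qed.

Lemma rees_form r f (Jf : ideal_pow J r f) : f%:P * 'X^r \in rees_pred J.
Proof.
apply/rees_predP => r'; rewrite coefCM coefXn; case: eqVneq => [->|_]; rewrite ?mulr1 // mulr0.
by case: (ideal_powP J r').
Qed.

Definition presented_form r : set S :=
  [set f | ideal_pow J r f /\
    forall p : rees J, rees_val p = f%:P * 'X^r -> presented p].

Lemma presented_form_ideal r : is_ideal (presented_form r).
Proof.
have [J0 JD JM] := ideal_powP J r; split.
- split=> // p p0; have -> : p = rees_elt 0; last exact: presented_rees.
  by apply: val_inj; rewrite /= p0 !rmorph0 mul0r.
- move=> x y [Jx Hx] [Jy Hy]; split=> [|p pE]; first exact: JD.
  have -> : p = Rees (rees_form Jx) + Rees (rees_form Jy).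
    by apply: val_inj; rewrite rmorphD /= pE polyCD mulrDl.
  exact (presentedD (Hx (Rees (rees_form Jx)) erefl) (Hy (Rees (rees_form Jy)) erefl)).
- move=> c x [Jx Hx]; split=> [|p pE]; first exact: JM.
  (* Modulo the irrelevant ideal, [c] acts as its constant term. *)
  pose c0 := c@_0%MM.
  apply: (@presented_fiber _ (rees_elt c0%:MP * Rees (rees_form Jx))); last first.
    exact (presentedM (presented_rees _) (Hx (Rees (rees_form Jx)) erefl)).
  apply/fiber_predP => r'.
  have -> : rees_val (p - rees_elt c0%:MP * Rees (rees_form Jx)) =
      ((c - c0%:MP) * x)%:P * 'X^r.
    rewrite rees_valB rees_valM /= pE rees_mapC.
    exact: polyC_mul_sub.
  rewrite coefCM coefXn; case: eqVneq => [->|_]; rewrite ?mulr1 ?mulr0; last first.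
    by case: (ideal_mulP (@irrelevant_ideal K n) (ideal_pow J r')).
  by apply: ideal_mul_mem => //; exact: sub_mcoeff0_irrelevant.
Qed.

Lemma presented_form1 : (J `<=` presented_form 1)%classic.
Proof.
move=> f; apply; split; first exact: presented_form_ideal.
move=> _ [j _ <-]; split=> [|p pE].
  by rewrite /= -[X in _ X]mulr1; apply: ideal_mul_mem => //; exact: mem_monomial_ideal.
have -> : p = rees_elt 'X_j; last exact: presented_rees.
by apply: val_inj; rewrite /= pE rees_mapX.
Qed.

Lemma presented_formP r : (ideal_pow J r `<=` presented_form r)%classic.
Proof.
elim: r => [|r IH].
  move=> f _; rewrite -[f]mulr1; have [_ _] := presented_form_ideal 0; apply.
  split=> // p pE; have -> : p = rees_elt 1; last exact: presented_rees.
  by apply: val_inj; rewrite /= pE !rmorph1 expr0 mulr1.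
move=> f; apply; split; first exact: presented_form_ideal.
move=> _ [x [y [Jx Jy ->]]]; split=> [|p pE]; first exact: ideal_mul_mem.
have [J1x Hx] := presented_form1 Jx; have [_ Hy] := IH _ Jy.
have -> : p = Rees (rees_form J1x) * Rees (rees_form Jy).
  by apply: val_inj; rewrite rmorphM /= pE polyCM expr1 mulrACA -exprS.
exact (presentedM (Hx (Rees (rees_form J1x)) erefl) (Hy (Rees (rees_form Jy)) erefl)).
Qed.

(** Induction on the degree in t, splitting off the top coefficient. *)
Lemma presentedP p : presented p.
Proof.
have [N] := ubnP (size (rees_val p)); elim: N p => // N IH p.
rewrite ltnS => sp; have /rees_predP Jp := valP p.
case: N => [|N] in IH sp *.
  have -> : p = rees_elt 0; last exact: presented_rees.
  by apply: val_inj; rewrite rees_elt0 rmorph0; apply/eqP; rewrite -size_poly_leq0.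
pose q : rees J := Rees (rees_form (Jp N)).
have -> : p = (p - q) + q by rewrite subrK.
apply: presentedD; last exact ((presented_formP (Jp N)).2 q erefl).
apply: IH; rewrite ltnS; apply/leq_sizeP => j; rewrite rees_valB /=.
rewrite coefB coefCM coefXn => jN; case: eqVneq => [->|ne]; rewrite ?mulr1 ?subrr //.
rewrite mulr0 subr0 nth_default //; apply: leq_trans sp _.
by rewrite ltn_neqAle eq_sym ne.
Qed.

Local Open Scope quotient_scope.

Definition fiber_map (F : T) : Q := \pi_Q (rees_elt F).

Lemma fiber_map_surj z : exists F, fiber_map F = z.
Proof.
have [F] := presentedP (repr z); rewrite Quotient.idealrBE reprK => /eqP zF.
by exists F; rewrite /fiber_map -zF.
Qed.

Lemma fiber_mapD F H : fiber_map (F + H) = fiber_map F + fiber_map H.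
Proof. by rewrite /fiber_map rees_eltD rmorphD. Qed.

Lemma fiber_mapM F H : fiber_map (F * H) = fiber_map F * fiber_map H.
Proof. by rewrite /fiber_map rees_eltM rmorphM. Qed.

Lemma fiber_map1 : fiber_map 1 = 1.
Proof. by rewrite /fiber_map rees_elt1 rmorph1. Qed.

Lemma fiber_map0 : fiber_map 0 = 0.
Proof. by rewrite /fiber_map rees_elt0 rmorph0. Qed.

Lemma fiber_map_ker F H : fiber_map F = fiber_map H <-> rees_elt (F - H) \in @fiber_pred K n J.
Proof.
rewrite rees_eltB Quotient.idealrBE.
by split=> [e|/eqP e]; [apply/eqP; exact e | exact e].
Qed.

Lemma rees_map_fiber_map F : rees_map F = 0 -> fiber_map F = 0.
Proof.
by move=> F0; rewrite -fiber_map0 /fiber_map; congr \pi_Q; apply: val_inj; rewrite /= F0 rmorph0.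
Qed.

(** The coefficient of t^r in the image is homogeneous of degree r d, while m J^r has order at least
    r d + 1. *)
Lemma equigenerated_fiber_ker d F : (forall j, mdeg (a j) = d) ->
  rees_elt F \in @fiber_pred K n J -> rees_map F = 0.
Proof.
move=> da /fiber_predP FJ; apply/polyP => r; apply/mpolyP => x; rewrite coef0 mcoeff0.
have Jd : (J `<=` order_ge d)%classic.
  apply: order_ge_gen => _ [j _ <-] m; rewrite msuppX inE => /eqP->.
  by rewrite da.
have FJr := order_ge_mul (@order_ge_irrelevant K n) (order_ge_pow (r := r) Jd) (FJ r).
have [xr|xr] := eqVneq (mdeg x) (r * d)%N.
  by apply/eqP; rewrite mcoeff_eq0; apply/negP => /FJr; rewrite xr add1n ltnn.
rewrite coef_rees_map big1_seq // => m /andP[/eqP[mr mx] _]; case/eqP: xr.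
rewrite -mx -mr /mono_exp mdeg_sum mdegE big_distrl /=.
by apply: eq_bigr => j _; rewrite mdegMn da mulnC.
Qed.

End FiberPresentation.

(** * Analytic spread and height *)

Section ToricDimension.
Variables (K : fieldType) (n g : nat) (a : 'I_g -> 'X_{1..n}).
Local Notation J := (@monomial_ideal K n g a).
Local Notation M := (homog_mx a).
Local Notation r := (\rank M^T).
Local Notation f := (@max_columns _ _ _ M).

Definition homog_entry j (c : 'I_(1 + n)) : nat :=
  if split c is inr l then a j l else 1%N.

Lemma homog_mxE j c : M j c = (homog_entry j c)%:R.
Proof.
rewrite mxE /homog_row mxE /homog_entry; case: (splitP c) => l _; last by rewrite mxE.
by rewrite mxE (ord1 l).
Qed.

Definition exp_row (m : 'X_{1..g}) : 'rV[rat]_g := \row_j (m j)%:R.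

Lemma exp_row_mulE m c : (exp_row m *m M) 0 c = (\sum_j homog_entry j c * m j)%:R.
Proof.
rewrite mxE natr_sum; apply: eq_bigr => j _.
by rewrite mxE homog_mxE -natrM mulnC.
Qed.

Lemma exp_row_homog m m' : exp_row m *m M = exp_row m' *m M <->
  (mdeg m, mono_exp a m) = (mdeg m', mono_exp a m').
Proof.
have E0 (m1 : 'X_{1..g}) : (\sum_j homog_entry j (lshift n ord0) * m1 j)%N = mdeg m1.
  rewrite mdegE; apply: eq_bigr => j _.
  by rewrite /homog_entry (unsplitK (inl _)) mul1n.
have E1 l (m1 : 'X_{1..g}) : (\sum_j homog_entry j (rshift 1 l) * m1 j)%N = mono_exp a m1 l.
  rewrite mono_expE; apply: eq_bigr => j _.
  by rewrite /homog_entry (unsplitK (inr _)).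
split=> [e|[e0 e1]].
  have eE c := congr1 (fun v : 'rV[rat]_(1 + n) => v 0 c) e.
  congr pair; first by apply/eqP; rewrite -!E0 -(eqr_nat rat) -!exp_row_mulE eE.
  by apply/mnmP=> l; apply/eqP; rewrite -!E1 -(eqr_nat rat) -!exp_row_mulE eE.
apply/rowP=> c; rewrite !exp_row_mulE; congr (_%:R).
rewrite -(splitK c); case: (split c) => l /=; last by rewrite !E1 e1.
by rewrite (ord1 l) !E0 e0.
Qed.

(* Exponents of the images of the generators, in the variables of the chosen
   columns, after the first i of these variables are set to 1. *)
Definition column_exp (i : nat) (j : 'I_g) : 'X_{1..r} :=
  [multinom (if (c < i)%N then 0 else homog_entry j (f c))%N | c < r].

Lemma column_mono_expE i m c : mono_exp (column_exp i) m c =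
  if (c < i)%N then 0%N else (\sum_j homog_entry j (f c) * m j)%N.
Proof.
rewrite mono_expE; case: ifP => ci.
  by rewrite big1 // => j _; rewrite mnmE ci mul0n.
by apply: eq_bigr => j _; rewrite mnmE ci.
Qed.

(** All columns are combinations of the chosen ones. *)
Lemma column_exp_determine m m' : mono_exp (column_exp 0) m = mono_exp (column_exp 0) m' ->
  (mdeg m, mono_exp a m) = (mdeg m', mono_exp a m').
Proof.
move=> e; apply/exp_row_homog/eqP; rewrite -subr_eq0 -mulmxBl; apply/eqP.
apply: max_columns_determine => c; rewrite mulmxBl mxE [X in _ + X]mxE !exp_row_mulE.
by move/mnmP/(_ c): e; rewrite !column_mono_expE ltn0 => ->; rewrite subrr.
Qed.

Lemma column_exp_determined i m m' :
    (mdeg m, mono_exp a m) = (mdeg m', mono_exp a m') ->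
  mono_exp (column_exp i) m = mono_exp (column_exp i) m'.
Proof.
move=> /exp_row_homog e; apply/mnmP=> c; rewrite !column_mono_expE; case: ifP => // _.
by apply/eqP; rewrite -(eqr_nat rat) -!exp_row_mulE e.
Qed.

(** The chain is pulled back along the surjection [fiber_map]. What the map to the chosen columns
    kills is zero in the Rees algebra, hence in the fiber ring, and so lies in the smallest
    prime. *)
Lemma fiber_chain_bound (C : nat -> set (fiber_ring J)) d : prime_chain C d -> (d <= r)%N.
Proof.
move=> [primeC ltC]; pose P i : set {mpoly K[g]} := [set F | C i (@fiber_map K n g a F)].
have surj z : exists F, @fiber_map K n g a F = z := fiber_map_surj z.
apply: (@prime_chain_bound K g r d (@mono_map K g r (column_exp 0)) P); first exact: mono_mapC.
- split=> i id.
    have [[C0 CD CM] nC1 CP] := primeC i id; split.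
    + split; rewrite /P /=; first by rewrite fiber_map0.
        by move=> x y; rewrite fiber_mapD; exact: CD.
      by move=> x y; rewrite fiber_mapM; exact: CM.
    + by rewrite /P /= fiber_map1.
    + by move=> x y; rewrite /P /= fiber_mapM; exact: CP.
  have [sub nsub] := ltC i id; split; first by move=> F; exact: sub.
  by move=> H; apply: nsub => z; have [F <-] := surj z; exact: H.
- move=> F /mono_map_eq0 F0; rewrite /P /= rees_map_fiber_map.
    by case: (primeC 0%N isT) => -[].
  by apply/rees_map_eq0; apply: fiber_sums_vanish_coarsen F0; exact: column_exp_determine.
Qed.

(** The exponents come from a multiple of a vector dual to the [i]-th chosen column: they agree on
    the other chosen columns, so setting that variable to 1 identifies them. *)
Lemma column_exp_separate (i : 'I_r) : exists m m',
  mono_exp (column_exp i.+1) m = mono_exp (column_exp i.+1) m' /\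
  mono_exp (column_exp i) m <> mono_exp (column_exp i) m'.
Proof.
have [v vE] := max_columns_dual i.
have [N [ep [em [N0 e]]]] := clear_denominators v.
have eN c : (\sum_j homog_entry j (f c) * ep j)%N =
    (\sum_j homog_entry j (f c) * em j + N * (c == i))%N.
  apply/eqP; rewrite -(eqr_nat rat) natrD natrM -vE mxE mulr_sumr !natr_sum -big_split /=.
  apply/eqP/eq_bigr => j _; rewrite !natrM homog_mxE mulrA (mulrC N%:R) e mulrBl.
  by rewrite !(mulrC _ (homog_entry _ _)%:R) addrC subrK.
exists [multinom ep j | j < g], [multinom em j | j < g].
have E h c : (\sum_j homog_entry j (f c) * [multinom h j | j < g] j =
    \sum_j homog_entry j (f c) * h j)%N by apply: eq_bigr => j _; rewrite mnmE.
split.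
  apply/mnmP=> c; rewrite !column_mono_expE !E eN.
  case: ifP => //; case: eqVneq => [->|_ _]; first by rewrite ltnSn.
  by rewrite muln0 addn0.
move/mnmP/(_ i); rewrite !column_mono_expE ltnn !E eN eqxx; lia.
Qed.

(** The primes are the images in the fiber ring of the kernels of the maps [sigma i] to domains.
    Because the generators have equal degree, these kernels contain that of [fiber_map]. *)
Lemma fiber_chain_exists d : (forall j, mdeg (a j) = d) ->
  exists C : nat -> set (fiber_ring J), prime_chain C r.
Proof.
move=> da; pose sigma i := @mono_map K g r (column_exp i).
pose theta := @fiber_map K n g a.
have ker F H i : theta F = theta H -> sigma i (F - H) = 0.
  move/fiber_map_ker/(equigenerated_fiber_ker da)/rees_map_eq0 => FH.
  apply/mono_map_eq0; apply: fiber_sums_vanish_coarsen FH => m m'.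
  exact: column_exp_determined.
have keq F H i : theta F = theta H -> sigma i F = sigma i H.
  by move/(ker _ _ i)/eqP; rewrite /sigma rmorphB subr_eq0 => /eqP.
have surj z : exists F, theta F = z := fiber_map_surj z.
have sD i F H : sigma i (F + H) = sigma i F + sigma i H by exact: rmorphD.
have sM i F H : sigma i (F * H) = sigma i F * sigma i H by exact: rmorphM.
exists (fun i => [set z | exists F, theta F = z /\ sigma i F = 0]); split=> i ir.
  split.
  - split; first by exists 0; rewrite /theta fiber_map0 /sigma rmorph0.
      move=> _ _ [F [<- F0]] [H [<- H0]]; exists (F + H).
      by rewrite /theta fiber_mapD sD F0 H0 addr0.
    move=> z _ [F [<- F0]]; have [H <-] := surj z; exists (H * F).
    by rewrite /theta fiber_mapM sM F0 mulr0.
  - case=> F [F1 F0]; have /(keq _ _ i) : theta F = theta 1 by rewrite F1 /theta fiber_map1.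
    by rewrite F0 /sigma rmorph1 => /eqP; rewrite eq_sym oner_eq0.
  - move=> z w [F [Fzw F0]]; have [X eX] := surj z; have [Y eY] := surj w.
    have : sigma i (X * Y) = 0.
      by rewrite -F0; apply: keq; rewrite Fzw -eX -eY /theta fiber_mapM.
    by rewrite sM => /eqP; rewrite mulf_eq0 => /orP[]/eqP e; [left; exists X|right; exists Y].
split=> [_ [F [<- /mono_map_eq0 F0]]|H].
  exists F; split=> //; apply/mono_map_eq0; apply: fiber_sums_vanish_coarsen F0 => m m' e.
  apply/mnmP=> c; move/mnmP/(_ c): e; rewrite !column_mono_expE ltnS.
  by case: ltnP => ci; [rewrite (ltnW ci)|case: ifP].
(* Strictness: this binomial is killed by [sigma i.+1] but not by [sigma i]. *)
have [m [m' [e ne]]] := column_exp_separate (Ordinal ir).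
have [|F [eF F0]] := H (theta ('X_[m] - 'X_[m'])).
  exists ('X_[m] - 'X_[m']); split=> //.
  by rewrite /sigma rmorphB /= !mono_mapX e subrr.
have := keq _ _ i eF; rewrite F0 /sigma rmorphB /= !mono_mapX => /esym/eqP.
rewrite subr_eq0 => /eqP/(congr1 (mcoeff (mono_exp (column_exp i) m))).
rewrite !mcoeffX eqxx; case: eqP => [/esym//|_] /eqP; by rewrite oner_eq0.
Qed.

End ToricDimension.

Section Spread.
Local Open Scope ereal_scope.
Variables (K : fieldType) (n g : nat) (a : 'I_g -> 'X_{1..n}).
Local Notation J := (@monomial_ideal K n g a).

Lemma analytic_spread_le : analytic_spread J <= (Posz (\rank (homog_mx a)))%:E.
Proof.
(* The value is a least upper bound or the default -oo. *)
rewrite /analytic_spread /krull_dim /supremum; case: ifP => // _.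
case: xgetP => [y _ [_ +]|//]; apply=> _ [d [C chC] <-].
by rewrite lee_fin lez_nat -mxrank_tr; exact: fiber_chain_bound chC.
Qed.

Lemma analytic_spread_eq d : (forall j, mdeg (a j) = d) ->
  analytic_spread J = (Posz (\rank (homog_mx a)))%:E.
Proof.
move=> da; apply/eqP; rewrite eq_le analytic_spread_le /=.
have [C chC] := fiber_chain_exists K da.
apply: ge_supremum_Nmem; last by exists (\rank (homog_mx a)) => //; exists C; rewrite -mxrank_tr.
exists (Posz (\rank (homog_mx a)))%:E; split.
  move=> _ [e [D chD] <-].
  by rewrite lee_fin lez_nat -mxrank_tr; exact: fiber_chain_bound chD.
by move=> y; apply; exists (\rank (homog_mx a)) => //; exists C; rewrite -mxrank_tr.
Qed.

End Spread.

(** * Monotonicity of the height *)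

Section Height.
Local Open Scope ereal_scope.

Lemma prime_height_values (A : comNzRingType) (P : set A) :
  prime_height P = -oo \/ prime_height P = +oo \/ exists d : nat, prime_height P = (Posz d)%:E.
Proof.
rewrite /prime_height /supremum; case: ifPn => [_|/set0P[x [d Cd _]]]; first by left.
case: xgetP => [y _ [/(_ (Posz d)%:E) ub _]|_]; last by left.
have {ub} : (Posz d)%:E <= y by apply: ub; exists d.
case: y => [z||] //; last by right; left.
by rewrite lee_fin => dz; right; right; exists `|z|%N; case: z dz.
Qed.

(** [infimum] is a choice with a default, so a greatest lower bound has to be exhibited: the least
    natural number in [B], unless -oo occurs or only +oo does. *)
Lemma infimum_attained (B : set (\bar int)) :
    (forall x, B x -> x = -oo \/ x = +oo \/ exists d : nat, x = (Posz d)%:E) ->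
  B !=set0 -> exists2 x, B x & lbound B x.
Proof.
move=> BV [x0 Bx0].
have [Bm|nBm] := pselect (B -oo); first by exists -oo => // y _; rewrite leNye.
have [[d Bd]|nB] := pselect (exists d : nat, B (Posz d)%:E); last first.
  exists +oo => [|y By].
    have := Bx0; case: (BV _ Bx0) => [->|[->|[d ->]]] // Bd; by case: nB; exists d.
  by case: (BV _ By) => [e|[->//|[d e]]]; [case: nBm; rewrite -e|case: nB; exists d; rewrite -e].
have exB : exists d, `[< B (Posz d)%:E >] by exists d; apply/asboolP.
have := ex_minnP exB; case=> e /asboolP Be emin.
exists (Posz e)%:E => // y By; case: (BV _ By) => [ey|[->|[d' ey]]].
- by case: nBm; rewrite -ey.
- by rewrite leey.
by rewrite ey lee_fin lez_nat; apply: emin; apply/asboolP; rewrite -ey.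
Qed.

(** The larger ideal lies in fewer primes; if it lies in none, its height is +oo. *)
Lemma height_le (A : comNzRingType) (I L : set A) : (I `<=` L)%classic -> height I <= height L.
Proof.
move=> IL; rewrite {2}/height /infimum; case: ifPn => [_|/set0P nL]; first by rewrite leey.
have vals (H : set A) x :
    [set prime_height P | P in [set P | prime_ideal P /\ (H `<=` P)%classic]]%classic x ->
    x = -oo \/ x = +oo \/ exists d : nat, x = (Posz d)%:E.
  by move=> [P _ <-]; exact: prime_height_values.
have [x Lx lbx] := infimum_attained (vals L) nL.
have sub y : [set prime_height P | P in [set P | prime_ideal P /\ (L `<=` P)%classic]]%classic y ->
    [set prime_height P | P in [set P | prime_ideal P /\ (I `<=` P)%classic]]%classic y.
  by move=> [P [pP LP] <-]; exists P => //; split=> // z /IL/LP.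
have [x' Ix' lbx'] := infimum_attained (vals I) (ex_intro _ x (sub _ Lx)).
case: xgetP => [y _ [lby uby]|/(_ x)[]]; last first.
  by split=> // z; apply.
have lex' : height I <= x'.
  by apply: le_infimum_Nmem => //; exists x'; split=> // z; apply.
apply: le_trans lex' _; apply: le_trans (lbx' _ (sub _ Lx)) _.
by apply: uby => z; exact: lbx.
Qed.

End Height.

Theorem corollary4p3 (K : fieldType) (n m d : nat) (u : 'I_m -> 'X_{1..n})
    (sqfree_u : forall i, squarefree_mnm (u i))
    (deg_u : forall i, mdeg (u i) = d)
    (F : mgraded_complex K n)
    (resF : minimal_mgraded_resolution F (B1 K u))
    (k : nat) :
  (height (homological_shift F k.+1) <= height (homological_shift F k))%E /\
  (analytic_spread (homological_shift F k.+1)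
     <= analytic_spread (homological_shift F k))%E.
Proof.
pose G := B1_generator K d u.
have degG g : G g -> mdeg g = d by case.
have borelG := @B1_generator_borel K n m d u.
have [grF rsF minF] := resF.
have shiftP k' w : (exists j : 'I_(mres_rank F k'), mres_shift j = w) <-> borel_shift d G k' w.
  apply: (shift_borel grF rsF minF) => //; last by move=> g [].
  by move=> b; exact: B1_mem.
split.
  (* Every shift of F_(k+1) is divisible by one of F_k, so the ideals are nested. *)
  apply: height_le => f; apply; split; first exact: ideal_genP.
  move=> _ [j _ <-].
  have [|x] := @borel_shift_pred n d G degG k (mres_shift j); first by apply/shiftP; exists j.
  case/shiftP=> j' <-; apply: monomial_ideal_geq; first exact: ideal_genP.
  by move=> I [_ GI]; apply: GI; exists j'.
have spread_eq := @analytic_spread_eq K n _ (fun j : 'I_(mres_rank F k) => mres_shift j) (d + k).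
rewrite [leRHS]spread_eq; last first.
  by move=> j; have [] := (shiftP k (mres_shift j)).1 (ex_intro _ j erefl).
(* For HS_(k+1) the upper bound by the rank suffices; equality for HS_k comes from the common degree
   d + k of its generators. *)
apply: le_trans (analytic_spread_le _ _) _; rewrite lee_fin lez_nat.
exact: (borel_shift_rank degG borelG (shiftP k) (shiftP k.+1)).
Qed.
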